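(* Let $s\in(1,2]$ and $m,n\in\mathbb{N}$. Then the set $H_s[0,1]=\{f\in C[0,1]:\dim_H G_f([0,1])=s\}$ is $(n,n+m)$-lineable.
   Context: $C[0,1]$ is the real vector space of real-valued continuous functions on $[0,1]$. $G_f(X)=\{(x,f(x)):x\in X\}$ is the graph of $f$ over $X$, and $\dim_H$ denotes Hausdorff dimension. For cardinals $\alpha<\beta$, a subset $A$ of a vector space is $\alpha$-lineable if there is an $\alpha$-dimensional linear subspace $M\subseteq A\cup\{0\}$, and it is $(\alpha,\beta)$-lineable if it is $\alpha$-lineable and for every $\alpha$-dimensional subspace $W_\alpha\subseteq A\cup\{0\}$ there exists a $\beta$-dimensional subspace $W_\beta$ with $W_\alpha\subseteq W_\beta\subseteq A\cup\{0\}$. *)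

(* Defs.v *)
From HB Require Import structures.
From mathcomp Require Import all_boot all_order all_algebra.
From mathcomp Require Import all_classical all_reals all_analysis.
Set Implicit Arguments. Unset Strict Implicit. Unset Printing Implicit Defensive.
Import Order.TTheory GRing.Theory Num.Theory.
Import numFieldNormedType.Exports.
Local Open Scope classical_set_scope.
Local Open Scope ring_scope.

Section HausdorffDim.
Variable R : realType.

Definition edist2 (p q : R * R) : R :=
  Num.sqrt ((p.1 - q.1) ^+ 2 + (p.2 - q.2) ^+ 2).

Definition diam2 (U : set (R * R)) : \bar R :=
  if U == set0 then 0%E
  else ereal_sup [set (edist2 p q)%:E | p in U & q in U].

Definition hcontent (s delta : R) (E : set (R * R)) : \bar R :=
  ereal_inf [set (\sum_(0 <= i <oo) ((fine (diam2 (U i))) `^ s)%:E)%E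
            | U in [set U : nat -> set (R * R) |
                     E `<=` \bigcup_i U i /\
                     forall i, (diam2 (U i) <= delta%:E)%E]].

(* s-dimensional Hausdorff (outer) measure: limit delta -> 0+,
   i.e. the supremum over delta > 0 (hcontent is nonincreasing in delta) *)
Definition hmeasure (s : R) (E : set (R * R)) : \bar R :=
  ereal_sup [set hcontent s delta E | delta in [set d : R | 0 < d]].

Definition hdim (E : set (R * R)) : \bar R :=
  ereal_inf [set s%:E | s in [set s : R | 0 <= s /\ hmeasure s E = 0%E]].

Definition graph (f : R -> R) (X : set R) : set (R * R) :=
  [set (x, f x) | x in X].

(* C[0,1] is represented by functions R -> R continuous on [0,1];
   two such functions are the same element of C[0,1] iff they agree on [0,1]. *)
Definition C01 (f : R -> R) : Prop := {within `[0%R, 1%R], continuous f}.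

Definition Hs (s : R) (f : R -> R) : Prop :=
  C01 f /\ hdim (graph f `[0%R, 1%R]) = s%:E.

Definition lincomb (k : nat) (c : 'I_k -> R) (f : 'I_k -> R -> R) : R -> R :=
  fun x => \sum_(i < k) c i * f i x.

Definition lin_indep01 (k : nat) (f : 'I_k -> R -> R) : Prop :=
  (forall i, C01 (f i)) /\
  forall c : 'I_k -> R,
    (forall x, x \in `[0, 1] -> lincomb c f x = 0) -> forall i, c i = 0.

(* the span of the family lies in A \cup {0}: every linear combination
   with not-all-zero coefficients belongs to A (for an independent family
   these are exactly the nonzero vectors of the span) *)
Definition span_in (A : (R -> R) -> Prop) (k : nat) (f : 'I_k -> R -> R) : Prop :=
  forall c : 'I_k -> R, (exists i, c i != 0) -> A (lincomb c f).

Definition lineable (A : (R -> R) -> Prop) (k : nat) : Prop :=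
  exists f : 'I_k -> R -> R, lin_indep01 f /\ span_in A f.

(* (a, b)-lineability for finite cardinals a < b: every a-dimensional
   subspace W_a of A \cup {0} (given by a basis f) extends to a
   b-dimensional subspace W_b of A \cup {0}; W_b is given by a basis
   extending that of W_a (any basis of W_a extends to one of W_b). *)
Definition lineable2 (A : (R -> R) -> Prop) (a b : nat) : Prop :=
  lineable A a /\
  forall f : 'I_a -> R -> R, lin_indep01 f -> span_in A f ->
    exists g : 'I_(a + (b - a)) -> R -> R,
      (forall i : 'I_a, g (lshift (b - a) i) = f i) /\
      lin_indep01 g /\ span_in A g.

End HausdorffDim.

(* Main.v *)
(** Fix a basis [f] of the given subspace.  Let [C] be the Cantor set of points
    [sum_j d_j (l_j - l_(j+1))], [d_j] binary digits, with
    [l_j = 2^(-j/(s-1)) / (j+1)], so that [dim C = s - 1].  The digits are cut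
    into consecutive blocks [[p_k, p_(k+1))], and [y_k] is the function equal on
    [C] to the binary number in [[0, 1]] written in block [k], extended so as to be
    Lipschitz and to vanish at some distance from [C] tending to [0] with [k].  The new basis
    vectors are [g_i = sum_(k = i mod b) 2^(-k) y_k].

    Upper bound: near a point off the closure of [C] only finitely many [y_k]
    are nonzero, so adding a combination of the [g_i] is there a Lipschitz
    shear, and the part of any graph over the closure of [C] has dimension at
    most [1 + (s - 1)].

    Lower bound: the [p_k] grow so fast, depending on the moduli of continuity
    of the [f_i], that at each scale [r] some block [k] with [2^(-k)] only
    logarithmically small in [1/r] starts where the [f_i] already vary by less
    than [r].  Freezing all the other digits, this block spreads the values over
    an interval of length about [2^(-k)], so a set of diameter [r] captures a
    proportion of about [r^s] of the digit sequences; the mass distribution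
    principle, with Lebesgue measure on the binary expansions, concludes. *)
Require Import Defs.
From mathcomp Require Import all_boot all_order all_algebra.
From mathcomp Require Import all_classical all_reals all_analysis.
From mathcomp Require Import ring lra zify.
Import Order.TTheory GRing.Theory Num.Theory.
Import numFieldNormedType.Exports.
Local Open Scope ring_scope.
Set Implicit Arguments.
Unset Strict Implicit.
Unset Printing Implicit Defensive.
Local Open Scope classical_set_scope.

(** * Sets of Hausdorff measure zero *)

Section HausdorffNull.
Variable R : realType.
Implicit Types (t del eps : R) (E : set (R * R)).

Lemma edist2_ge0 (p q : R * R) : 0 <= edist2 p q.
Proof. exact: sqrtr_ge0. Qed.

Lemma edist2_lex (p q : R * R) : `|p.1 - q.1| <= edist2 p q.
Proof. by rewrite -sqrtr_sqr ler_wsqrtr// lerDl sqr_ge0. Qed.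

Lemma edist2_ley (p q : R * R) : `|p.2 - q.2| <= edist2 p q.
Proof. by rewrite -sqrtr_sqr ler_wsqrtr// lerDr sqr_ge0. Qed.

Lemma edist2_le (p q : R * R) : edist2 p q <= `|p.1 - q.1| + `|p.2 - q.2|.
Proof.
rewrite -(ler_pXn2r (n := 2))// ?nnegrE ?edist2_ge0 ?addr_ge0//.
rewrite sqr_sqrtr ?addr_ge0 ?sqr_ge0// [leRHS]sqrrD !real_normK ?num_real//.
by rewrite addrAC lerDl mulrn_wge0// mulr_ge0.
Qed.

Lemma diam2_ge0 (U : set (R * R)) : (0 <= diam2 U)%E.
Proof.
rewrite /diam2; case: ifPn => // /set0P[p Up].
apply: (@le_trans _ _ (edist2 p p)%:E); first by rewrite lee_fin edist2_ge0.
by apply: ereal_sup_ubound; exists p => //; exists p.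
Qed.

Lemma edist2_le_diam2 (U : set (R * R)) p q :
  U p -> U q -> ((edist2 p q)%:E <= diam2 U)%E.
Proof.
move=> Up Uq; rewrite /diam2; case: ifPn => [/eqP U0|_]; first by rewrite U0 in Up.
by apply: ereal_sup_ubound; exists p => //; exists q.
Qed.

Lemma diam2_le (U : set (R * R)) (r : R) : 0 <= r ->
  (forall p q, U p -> U q -> edist2 p q <= r) -> (diam2 U <= r%:E)%E.
Proof.
move=> r0 Ur; rewrite /diam2; case: ifPn => // _.
by apply: ge_ereal_sup => _ [p Up [q Uq <-]]; rewrite lee_fin Ur.
Qed.

(** Vanishing of the [t]-dimensional measure in terms of real radii and finite partial sums; for
    [0 < t] it is equivalent to [hmeasure t E = 0]. Covers can then be transformed without extended
    reals. *)
Definition hnull t E := forall eps del, 0 < eps -> 0 < del ->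
  exists (U : nat -> set (R * R)) (r : nat -> R),
  [/\ E `<=` \bigcup_i U i,
      forall i, 0 <= r i <= del,
      forall i p q, U i p -> U i q -> edist2 p q <= r i &
      forall N, \sum_(i < N) r i `^ t <= eps].

Lemma hnull_hmeasure0 t E : 0 < t -> hnull t E -> hmeasure t E = 0%E.
Proof.
move=> t0 nE; apply/eqP; rewrite eq_le; apply/andP; split.
  apply: ge_ereal_sup => _ [del /= del0 <-].
  apply/lee_addgt0Pr => eps eps0; rewrite add0e.
  have [U [r [EU rdel Ur rt]]] := nE _ _ eps0 del0.
  have Ule i : (diam2 (U i) <= (r i)%:E)%E.
    by apply: diam2_le => [|p q]; [case/andP: (rdel i)|exact: Ur].
  apply: (@le_trans _ _
      (\sum_(0 <= i <oo) ((fine (diam2 (U i))) `^ t)%:E)%E).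
    apply: ereal_inf_lbound; exists U => //; split => // i.
    by apply: (le_trans (Ule i)); rewrite lee_fin; case/andP: (rdel i).
  apply: lime_le.
    by apply: is_cvg_nneseries => n _ _; rewrite lee_fin powR_ge0.
  near=> N; rewrite sumEFin lee_fin big_mkord; apply: le_trans (rt N).
  apply: ler_sum => i _; apply: ge0_ler_powR; first exact: ltW.
  - by rewrite nnegrE fine_ge0// diam2_ge0.
  - by rewrite nnegrE; case/andP: (rdel i).
  - rewrite -lee_fin fineK ?Ule// ge0_fin_numE ?diam2_ge0//.
    exact: le_lt_trans (Ule i) (ltry _).
apply: (@le_trans _ _ (hcontent t 1 E)); last first.
  by apply: ereal_sup_ubound; exists 1 => /=.
apply: le_ereal_inf_tmp => _ [U _ <-].
by apply: nneseries_ge0 => n _ _; rewrite lee_fin powR_ge0.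
Unshelve. all: by end_near. Qed.

Lemma hmeasure0_hnull t t' E :
  0 <= t <= t' -> 0 < t' -> hmeasure t E = 0%E -> hnull t' E.
Proof.
move=> /andP[t0 tt'] t'0 E0 eps del eps0 del0.
(* With diameters at most 1, each term can only decrease when the exponent grows from [t] to
   [t']. *)
pose d := Num.min del 1.
have d0 : 0 < d by rewrite lt_min del0 ltr01.
have : (hcontent t d E < eps%:E)%E.
  apply: (@le_lt_trans _ _ (hmeasure t E)); last by rewrite E0 lte_fin.
  by apply: ereal_sup_ubound; exists d.
move=> /ereal_inf_lt [_ [U [EU Ud] <-] Ueps].
have Ufin i : (diam2 (U i) \is a fin_num).
  by rewrite ge0_fin_numE ?diam2_ge0// (le_lt_trans (Ud i)) ?ltry.
exists U, (fun i => fine (diam2 (U i))); split => //.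
- move=> i; rewrite fine_ge0 ?diam2_ge0//=.
  rewrite -lee_fin fineK//; apply: (le_trans (Ud i)).
  by rewrite lee_fin ge_min lexx.
- move=> i p q Up Uq; rewrite -lee_fin fineK//; exact: edist2_le_diam2.
- move=> N; rewrite -lee_fin; apply/ltW/(le_lt_trans _ Ueps).
  apply: (@le_trans _ _ (\sum_(0 <= i < N) (fine (diam2 (U i)) `^ t)%:E)%E).
    rewrite sumEFin big_mkord lee_fin; apply: ler_sum => i _.
    have := diam2_ge0 (U i).
    have := Ud i; rewrite -(fineK (Ufin i)) !lee_fin.
    move: (fine _) => x xd; rewrite le_eqVlt => /predU1P[<-|x0].
      by rewrite powR0 ?powR_ge0// gt_eqF.
    by apply: ger_powR => //; rewrite x0/= (le_trans xd)// ge_min lexx orbT.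
  by apply: nneseries_lim_ge => n _ _; rewrite lee_fin powR_ge0.
Qed.

Lemma hnullS t E E' : E `<=` E' -> hnull t E' -> hnull t E.
Proof.
move=> EE' nE' eps del e0 d0; have [U [r [? ? ? ?]]] := nE' _ _ e0 d0.
by exists U, r; split => //; exact: subset_trans EE' _.
Qed.

(** Padding a finite cover with empty sets of radius 0 costs nothing, because the power of 0 with
    exponent [t > 0] is 0. *)
Lemma hnull_finite t E : 0 < t ->
  (forall eps del, 0 < eps -> 0 < del ->
    exists (M : nat) (r : R) (V : nat -> set (R * R)),
    [/\ 0 <= r <= del, M%:R * r `^ t <= eps,
      forall x, E x -> exists2 i, (i < M)%N & V i x &
      forall i p q, V i p -> V i q -> edist2 p q <= r]) -> hnull t E.
Proof.
move=> t0 fE eps del e0 d0.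
have [M [r [V [rd Mr EV Vr]]]] := fE _ _ e0 d0.
exists (fun i => if (i < M)%N then V i else set0), (fun i => if (i < M)%N then r else 0).
split => [x /EV[i iM Vx]|i|i p q|N].
- by exists i => //; rewrite iM.
- by case: ifP => // _; rewrite lexx ltW.
- by case: ifP => // _; exact: Vr.
- apply: le_trans Mr.
  rewrite -(big_mkord xpredT (fun i => (if (i < M)%N then r else 0) `^ t)).
  apply: (@le_trans _ _ (\sum_(0 <= i < N) if (i < M)%N then r `^ t else 0)).
    apply: ler_sum => i _; case: ifP => // _; rewrite powR0 ?gt_eqF//.
  rewrite -big_mkcond/= big_const_seq iter_addr_0 -[leLHS]mulr_natl.
  apply: ler_wpM2r; first exact: powR_ge0.
  rewrite ler_nat -size_filter -[leqRHS](size_iota 0) uniq_leq_size ?filter_uniq ?iota_uniq//.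
  by move=> i; rewrite mem_filter !mem_iota /= => /andP[->].
Qed.

(** Finitely many indices are sent by [f] into a finite square of pairs, so a double sum can be
    enumerated in any order without forming infinite sums. *)
Lemma sum_pairing_le (f : nat -> nat * nat) (g : nat * nat -> R) (e : R) :
  injective f -> (forall p, 0 <= g p) ->
  (forall N, \sum_(n < N) \sum_(i < N) g (n : nat, i : nat) <= e) ->
  forall J, \sum_(j < J) g (f j) <= e.
Proof.
move=> finj g0 ge J.
pose N := \max_(j < J) maxn (f j).1 (f j).2.
have fN (j : 'I_J) : ((f j).1 < N.+1)%N && ((f j).2 < N.+1)%N.
  by rewrite !ltnS -geq_max; exact: (leq_bigmax j).
pose h (j : 'I_J) : 'I_N.+1 * 'I_N.+1 := (inord (f j).1, inord (f j).2).
have hE j : ((h j).1 : nat, (h j).2 : nat) = f j.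
  by rewrite /h /= !inordK; [case: (f j)|case/andP: (fN j)..].
have hinj : injective h.
  by move=> i j hij; apply/val_inj/finj; rewrite -!hE hij.
apply: le_trans (ge N.+1); rewrite pair_big /=.
under eq_bigr => j _ do rewrite -hE.
rewrite -(big_imset (fun p : 'I_N.+1 * 'I_N.+1 => g (p.1 : nat, p.2 : nat)) (h := h) (A := predT))/=; last first.
  by move=> i j _ _ /hinj.
by rewrite big_mkcond/=; apply: ler_sum => p _; case: ifP.
Qed.

Lemma sum_half_le (N : nat) : \sum_(i < N) (2^-1 : R) ^+ i.+1 <= 1.
Proof.
have -> : \sum_(i < N) (2^-1 : R) ^+ i.+1 = 1 - 2^-1 ^+ N.
  elim: N => [|N IH]; first by rewrite big_ord0 expr0 subrr.
  by rewrite big_ord_recr /= IH exprS; field.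
by rewrite lerBlDr lerDl exprn_ge0// invr_ge0.
Qed.

Lemma hnull_bigcup t (E : nat -> set (R * R)) :
  (forall n, hnull t (E n)) -> hnull t (\bigcup_n E n).
Proof.
move=> nE eps del e0 d0.
pose ep n : R := eps * 2^-1 ^+ n.+1.
have ep0 n : 0 < ep n by rewrite mulr_gt0// exprn_gt0.
have /choice[U HU] : forall n, exists U : nat -> set (R * R) , exists (r : nat -> R),
  [/\ E n `<=` \bigcup_i U i, forall i, 0 <= r i <= del,
      forall i p q, U i p -> U i q -> edist2 p q <= r i &
      forall N, \sum_(i < N) r i `^ t <= ep n] by move=> n; exact: nE.
have /choice[r Hr] := HU.
have /card_esym/ppcard_eqP[f] := card_nat2.
exists (fun j => U (f j).1 (f j).2), (fun j => r (f j).1 (f j).2); split.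
- move=> x [n _ Enx]; have [+ _ _ _] := Hr n; move=> /(_ _ Enx)[i _ Uix].
  by exists (f^-1%FUN (n, i)) => //; rewrite invK ?inE.
- by move=> j; have [_ + _ _] := Hr (f j).1; exact.
- by move=> j; have [_ _ + _] := Hr (f j).1; exact.
- apply: (@sum_pairing_le f (fun p => r p.1 p.2 `^ t)).
  + by move=> i j; apply: inj; rewrite inE.
  + by move=> p; exact: powR_ge0.
  + move=> N; apply: (@le_trans _ _ (\sum_(n < N) ep n)).
      by apply: ler_sum => n _; have [_ _ _] := Hr n; exact.
    by rewrite -mulr_sumr -[leRHS]mulr1 ler_pM2l// sum_half_le.
Qed.

Lemma hnullU t E E' : hnull t E -> hnull t E' -> hnull t (E `|` E').
Proof.
move=> nE nE'; apply: (@hnullS _ _ (\bigcup_n (if n is 0%N then E else E'))).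
  by move=> x [Ex|Ex]; [exists 0%N|exists 1%N].
by apply: hnull_bigcup; case.
Qed.

Lemma hnull_lipschitz t (L : R) (T : R * R -> R * R) E : 0 < t -> 0 < L ->
  (forall p q, edist2 (T p) (T q) <= L * edist2 p q) ->
  hnull t E -> hnull t (T @` E).
Proof.
move=> t0 L0 TL nE eps del e0 d0.
have [||U [r [EU rd Ur rt]]] := nE (eps / L `^ t) (del / L).
- by rewrite divr_gt0// powR_gt0.
- by rewrite divr_gt0.
exists (fun i => T @` U i), (fun i => L * r i); split.
- by move=> _ [x /EU[i _ Uix] <-]; exists i => //; exists x.
- move=> i; have /andP[r0 rle] := rd i.
  by rewrite mulr_ge0// ?(ltW L0)//= mulrC -ler_pdivlMr.
- move=> i _ _ [p Up <-] [q Uq <-]; apply: (le_trans (TL _ _)).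
  by rewrite ler_pM2l// Ur.
- move=> N; under eq_bigr => i _.
    rewrite powRM; [|exact: ltW|by case/andP: (rd i)].
    over.
  by rewrite -mulr_sumr mulrC -ler_pdivlMr ?powR_gt0.
Qed.

(** Positive radii are wanted in order to place each one between two consecutive lengths [ell n]. A
    zero radius is replaced by [z i]; the [t]-th powers of these add up to at most [eps / 2]. *)
Lemma hnull_pos t E : 0 < t -> hnull t E -> forall eps del, 0 < eps -> 0 < del ->
  exists (U : nat -> set (R * R)) (r : nat -> R),
  [/\ E `<=` \bigcup_i U i,
      forall i, 0 < r i <= del,
      forall i p q, U i p -> U i q -> edist2 p q <= r i &
      forall N, \sum_(i < N) r i `^ t <= eps].
Proof.
move=> t0 nE eps del e0 d0.
have [||U [r [EU rd Ur rt]]] := nE (eps / 2) del; rewrite ?divr_gt0//.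
pose z i : R := Num.min del ((eps / 2 * 2^-1 ^+ i.+1) `^ t^-1).
have ez i : 0 < eps / 2 * 2^-1 ^+ i.+1 by rewrite mulr_gt0 ?divr_gt0 ?exprn_gt0.
have z0 i : 0 < z i by rewrite lt_min d0 powR_gt0.
exists U, (fun i => if r i == 0 then z i else r i); split => //.
- move=> i; case: eqP => ri; first by rewrite z0 ge_min lexx.
  by have /andP[r0 ->] := rd i; rewrite andbT lt_neqAle r0 eq_sym; case: eqP.
- move=> i p q Up Uq; apply: (le_trans (Ur _ _ _ Up Uq)).
  by case: eqP => // ->; exact: ltW.
- move=> N.
  apply: (@le_trans _ _ (\sum_(i < N) (r i `^ t + eps / 2 * 2^-1 ^+ i.+1))).
    apply: ler_sum => i _; case: eqP => [ri|_]; last by rewrite lerDl ltW.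
    rewrite ri powR0 ?gt_eqF// add0r.
    apply: (@le_trans _ _ (((eps / 2 * 2^-1 ^+ i.+1) `^ t^-1) `^ t)).
      apply: ge0_ler_powR; rewrite ?nnegrE ?powR_ge0 ?(ltW t0) ?(ltW (z0 _))//.
      by rewrite ge_min lexx orbT.
    by rewrite -powRrM mulVf ?gt_eqF// powRr1// ltW.
  rewrite big_split/= -mulr_sumr [leRHS](_ : _ = eps / 2 + eps / 2); last by field.
  by apply: lerD (rt N) _; rewrite -[leRHS]mulr1 ler_pM2l ?divr_gt0// sum_half_le.
Qed.

Lemma hdim_eq (s : R) E : 0 < s ->
  (forall t, s < t -> hnull t E) ->
  (exists2 t0, t0 < s & forall t, t0 < t < s -> ~ hnull t E) ->
  hdim E = s%:E.
Proof.
move=> s0 up [t0 t0s lo]; apply/eqP; rewrite eq_le; apply/andP; split.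
  apply/lee_addgt0Pr => e e0; rewrite -EFinD.
  apply: ereal_inf_lbound; exists (s + e) => //; split; first by rewrite addr_ge0 ?ltW.
  by apply: hnull_hmeasure0; [rewrite addr_gt0|apply: up; rewrite ltrDl].
apply: le_ereal_inf_tmp => _ [t [tge0 Et] <-]; rewrite lee_fin leNgt; apply/negP => ts.
(* The midpoint of [u] and [s] lies above [t], [t0] and 0 and below [s]; nullity passes up to it
   from the exponent [t]. *)
pose u := Num.max t (Num.max 0 t0).
have us : u < s by rewrite !gt_max ts s0 t0s.
have [tu u0 tu0] : [/\ t <= u, 0 <= u & t0 <= u] by rewrite !le_max !lexx ?orbT.
apply: (lo ((u + s) / 2)); first by lra.
by apply: (hmeasure0_hnull _ _ Et); lra.
Qed.

Lemma hdim_hnull (s t : R) E : 0 <= s < t -> hdim E = s%:E -> hnull t E.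
Proof.
move=> /andP[s0 st] Es.
have : (hdim E < t%:E)%E by rewrite Es lte_fin.
move=> /ereal_inf_lt[_ [u [u0 Eu] <-]]; rewrite lte_fin => ut.
by apply: (hmeasure0_hnull _ _ Eu); lra.
Qed.

End HausdorffNull.

(** * Binary digits and Lebesgue measure *)

Section Digits.
Implicit Types d : nat -> bool.

(** The first digit is the most significant, so quotient and remainder by a power of 2 split a
    prefix into an initial and a final part. *)
Fixpoint prefix_val n d : nat :=
  if n is k.+1 then ((prefix_val k d).*2 + d k)%N else 0%N.

Definition dshift p d : nat -> bool := fun j => d (p + j)%N.

Lemma prefix_val_lt n d : (prefix_val n d < 2 ^ n)%N.
Proof. by elim: n => //= n IH; rewrite expnS; case: (d n) => /=; lia. Qed.

Lemma prefix_valD p q d :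
  prefix_val (p + q) d = (prefix_val p d * 2 ^ q + prefix_val q (dshift p d))%N.
Proof.
elim: q => [|q IH]; first by rewrite addn0 muln1 addn0.
by rewrite addnS /= IH expnS /dshift; lia.
Qed.

Lemma prefix_val_inj n d d' : prefix_val n d = prefix_val n d' ->
  forall j, (j < n)%N -> d j = d' j.
Proof.
elim: n => //= n IH dd' j.
have [b b'] : d n = d' n /\ prefix_val n d = prefix_val n d'.
  by case: (d n) (d' n) dd' => [] [] /= dd'; split; lia.
by rewrite ltnS leq_eqVlt => /predU1P[->//|]; exact: IH.
Qed.

Lemma eq_prefix_val n d d' : (forall j, (j < n)%N -> d j = d' j) ->
  prefix_val n d = prefix_val n d'.
Proof.
by elim: n => //= n IH h; rewrite h// IH// => j jn; apply: h; rewrite ltnS ltnW.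
Qed.

Lemma prefix_val_divn p q d : (prefix_val (p + q) d %/ 2 ^ q)%N = prefix_val p d.
Proof. by rewrite prefix_valD divnMDl ?expn_gt0// divn_small ?addn0 ?prefix_val_lt. Qed.

Lemma prefix_val_modn p q d :
  (prefix_val (p + q) d %% 2 ^ q)%N = prefix_val q (dshift p d).
Proof. by rewrite prefix_valD modnMDl modn_small// prefix_val_lt. Qed.

End Digits.

Section BinaryExpansion.
Variable R : realType.

Definition digits (u : R) : nat -> bool :=
  fun j => odd (Num.truncn (u * 2 ^+ j.+1)).

Lemma prefix_val_digits n (u : R) : 0 <= u < 1 ->
  prefix_val n (digits u) = Num.truncn (u * 2 ^+ n).
Proof.
move=> /andP[u0 u1]; elim: n => [|n IH].
  by apply/esym/truncn_def; rewrite expr0 mulr1 u0.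
rewrite [LHS]/= IH /digits exprS.
set x := u * 2 ^+ n; have x0 : 0 <= x by rewrite mulr_ge0// exprn_ge0.
have -> : u * (2 * 2 ^+ n) = 2 * x by rewrite /x; ring.
have /andP[a b] := truncn_itv x0.
have /andP[a' b'] := truncn_itv (mulr_ge0 (ler0n _ 2) x0 : 0 <= 2 * x).
move: a b a' b'; set y := Num.truncn x; set z := Num.truncn _ => a b a' b'.
have : (y.*2 <= z)%N by rewrite truncn_ge_nat ?mulr_ge0// -mul2n natrM; lra.
have : (z < y.*2.+2)%N.
  by rewrite truncn_lt_nat ?mulr_ge0// -doubleS -mul2n natrM; lra.
have := odd_double_half z; case: (odd z) => /=; lia.
Qed.

(** For [z < 2 ^ L], these are the points of [0, 1) whose first [L] binary digits spell [z]. *)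
Let dyadic L z : set R := `[z%:R / 2 ^+ L, z.+1%:R / 2 ^+ L[.

Lemma lebesgue_dyadic_union L (s : seq nat) :
  measurable (\big[setU/set0]_(z <- s) dyadic L z) /\
  (lebesgue_measure (\big[setU/set0]_(z <- s) dyadic L z) <=
    ((size s)%:R / 2 ^+ L)%:E)%E.
Proof.
elim: s => [|z s [mB IH]].
  by rewrite big_nil measure0 mul0r; split => //; exact: measurable0.
rewrite big_cons; have mz : measurable (dyadic L z) by exact: measurable_itv.
split; first exact: measurableU.
apply: (le_trans (measureU2 (@lebesgue_measure R) mz mB)).
rewrite [size _]/= -natr1 addrC mulrDl EFinD; apply: leeD => //.
have h : (lebesgue_measure (dyadic L z) <= (1 / 2 ^+ L)%:E)%E; last exact: h.
rewrite /dyadic lebesgue_measure_itv/= lte_fin ltr_pM2r ?invr_gt0 ?exprn_gt0//.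
by rewrite ltr_nat ltnSn -EFinB lee_fin -mulrBl -natrB// subSnn.
Qed.

(** The mass distribution principle in terms of digits: the points with a prefix in [S i] have
    Lebesgue measure at most [a i], and together they fill [0, 1), so countable subadditivity
    applies. *)
Lemma digits_cover (L : nat -> nat) (S : nat -> seq nat) (a : nat -> R) (e : R) :
  (forall u, 0 <= u < 1 -> exists i, prefix_val (L i) (digits u) \in S i) ->
  (forall i, (size (S i))%:R <= a i * 2 ^+ L i) ->
  (forall N, \sum_(i < N) a i <= e) -> 1 <= e.
Proof.
move=> cov Sa ae.
pose B i := \big[setU/set0]_(z <- S i) dyadic (L i) z.
have BP i := lebesgue_dyadic_union (L i) (S i).
have cB : `[0, 1[ `<=` \bigcup_i B i.
  move=> u; rewrite /= in_itv/= => u01; have [i uS] := cov u u01.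
  exists i => //; rewrite /B -bigcup_seq; eexists; first exact: uS.
  rewrite prefix_val_digits//= /dyadic /= in_itv/=.
  have u0 : 0 <= u * 2 ^+ L i by rewrite mulr_ge0 ?exprn_ge0//; case/andP: u01.
  have := truncn_itv u0.
  by rewrite ler_pdivrMr ?exprn_gt0// ltr_pdivlMr ?exprn_gt0.
have := @measure_sigma_subadditive _ R _ (@lebesgue_measure R) _ B
  (fun i => (BP i).1) (measurable_itv _) cB.
move=> /(fun h => h : is_true _) h.
have l1 : ((1 : R)%:E <= lebesgue_measure (`[0%R, 1%R[ : set R))%E.
  by rewrite lebesgue_measure_itv/= lte_fin ltr01 oppr0 adde0.
rewrite -lee_fin; apply: (le_trans l1); apply: (le_trans h); apply: lime_le.
  by apply: is_cvg_nneseries => n _ _.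
near=> N; apply: (@le_trans _ _ (\sum_(0 <= i < N) (a i)%:E)%E).
  apply: lee_sum => i _; apply: (le_trans (BP i).2).
  by rewrite lee_fin ler_pdivrMr ?exprn_gt0.
by rewrite sumEFin lee_fin big_mkord.
Unshelve. all: by end_near. Qed.

End BinaryExpansion.

(** * Counting in finite lists of naturals *)

Section Counting.

Lemma size_fibers (T : eqType) (f : nat -> T) (t : seq T) (s : seq nat) M :
  uniq s -> (forall z, z \in s -> f z \in t) ->
  (forall y, (size [seq z <- s | f z == y] <= M)%N) ->
  (size s <= size t * M)%N.
Proof.
elim: t s => [|y t IH] s us st sM.
  by case: s us st sM => // z s _ /(_ z (mem_head _ _)).
rewrite -(count_predC (fun z => f z == y) s) -!size_filter /= mulSn leq_add//.
apply: IH; first exact: filter_uniq.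
  by move=> z; rewrite mem_filter /= => /andP[zy /st]; rewrite in_cons (negbTE zy).
move=> y'; apply: leq_trans (sM y'); rewrite -filter_predI !size_filter.
by apply: sub_count => z /andP[].
Qed.

Lemma size_spread (s : seq nat) D :
  uniq s -> (forall x y, x \in s -> y \in s -> (x <= y + D)%N) ->
  (size s <= D.+1)%N.
Proof.
case: s => // x0 s us sD; set s' := x0 :: s in us sD *.
have ex : exists x, x \in s' by exists x0; rewrite mem_head.
have [m ms mmin] := ex_minnP ex.
rewrite -[leqRHS](size_iota m) uniq_leq_size// => x xs.
by rewrite mem_iota mmin//= addnS ltnS sD.
Qed.

End Counting.

(** * The Cantor set and functions on it *)

Lemma geometric_small (R : realType) (c z e : R) : 0 <= z < 1 -> 0 < e ->
  exists N, forall n, (N <= n)%N -> c * z ^+ n < e.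
Proof.
move=> /andP[z0 z1] e0; have := @cvg_geometric R c z; rewrite ger0_norm// => /(_ z1).
move=> /cvgrPdist_lt/(_ _ e0)[N _ HN]; exists N => n /HN.
rewrite sub0r normrN /geometric/=; exact/le_lt_trans/ler_norm.
Qed.

Lemma half_power_small (R : realType) (c e : R) : 0 < e ->
  exists N, forall n, (N <= n)%N -> c * 2^-1 ^+ n < e.
Proof. by apply: geometric_small; lra. Qed.

Section CantorSet.
Variable R : realType.
Variables ell eta : nat -> R.
Hypothesis ell0 : ell 0%N = 1.
Hypothesis ell_gt0 : forall n, 0 < ell n.
Hypothesis ell_half : forall n, 2 * ell n.+1 <= ell n.
Hypothesis eta_gap : forall m n, (m <= n)%N -> eta n <= ell m - 2 * ell m.+1.
Implicit Types d : nat -> bool.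

(** The left endpoint of the cylinder of level [n], an interval of length [ell n]. A digit 1 at
    place [j] selects the right child, which starts [ell j - ell j.+1] further on. *)
Definition cantor_base n d : R := \sum_(j < n) (d j)%:R * (ell j - ell j.+1).

(** The left endpoints increase with the level, so their supremum is the sum of the series. *)
Definition cantor_point d : R := sup (range (cantor_base^~ d)).

Lemma cantor_baseS n d : cantor_base n.+1 d = cantor_base n d + (d n)%:R * (ell n - ell n.+1).
Proof. by rewrite /cantor_base big_ord_recr. Qed.

Lemma eq_cbase n d d' : (forall j, (j < n)%N -> d j = d' j) -> cantor_base n d = cantor_base n d'.
Proof. by move=> dd'; apply: eq_bigr => j _; rewrite dd'. Qed.

Lemma ellS n : ell n.+1 <= ell n.
Proof. by have := ell_half n; have := ell_gt0 n.+1; lra. Qed.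

Lemma ell_le m n : (m <= n)%N -> ell n <= ell m.
Proof.
move=> /subnKC <-; elim: (n - m)%N => [|k IH]; first by rewrite addn0.
by rewrite addnS (le_trans (ellS _)).
Qed.

Lemma ell_le_half n : ell n <= 2^-1 ^+ n.
Proof.
elim: n => [|n IH]; first by rewrite ell0 expr0.
by rewrite exprS; have := ell_half n; lra.
Qed.

Lemma cantor_base_bounds n N d : (n <= N)%N ->
  cantor_base n d <= cantor_base N d <= cantor_base n d + (ell n - ell N).
Proof.
move=> /subnKC <-; elim: (N - n)%N => [|k IH]; first by rewrite addn0 subrr addr0 lexx.
rewrite addnS cantor_baseS; have := ellS (n + k).
by case: (d (n + k)) => /= h; lra.
Qed.

Lemma cantor_base_ub n d : ubound (range (cantor_base^~ d)) (cantor_base n d + ell n).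
Proof.
move=> _ [N _ <-]; have [nN|/ltnW Nn] := leqP n N.
  by have := cantor_base_bounds d nN; have := ell_gt0 N; lra.
by have := cantor_base_bounds d Nn; have := ell_gt0 n; lra.
Qed.

Lemma cantor_point_bounds n d : cantor_base n d <= cantor_point d <= cantor_base n d + ell n.
Proof.
apply/andP; split.
  by apply: ub_le_sup; [exists (cantor_base 0 d + ell 0); exact: cantor_base_ub|exists n].
by apply: ge_sup; [exists (cantor_base 0 d), 0%N|exact: cantor_base_ub].
Qed.

Lemma cantor_point01 d : 0 <= cantor_point d <= 1.
Proof. by have := cantor_point_bounds 0 d; rewrite /cantor_base big_ord0 ell0 add0r. Qed.

Lemma cantor_point_near n d d' : (forall j, (j < n)%N -> d j = d' j) ->
  `|cantor_point d - cantor_point d'| <= ell n.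
Proof.
move=> /eq_cbase dd'; have := cantor_point_bounds n d; have := cantor_point_bounds n d'.
by rewrite dd' ler_norml; lra.
Qed.

(** At the first differing digit [j] the points lie in the two children of one cylinder of level
    [j], and these are [ell j - 2 * ell j.+1] apart. *)
Lemma cantor_point_sep n d d' : (exists2 j, (j <= n)%N & d j != d' j) ->
  eta n <= `|cantor_point d - cantor_point d'|.
Proof.
move=> [j0 j0n dj0]; have ex : exists j, d j != d' j by exists j0.
have [j dj jmin] := ex_minnP ex.
have jn : (j <= n)%N := leq_trans (jmin _ dj0) j0n.
have /eq_cbase b : forall i, (i < j)%N -> d i = d' i.
  by move=> i ij; apply/eqP; apply: contraTT ij => /jmin; rewrite -leqNgt.
have := cantor_point_bounds j.+1 d; have := cantor_point_bounds j.+1 d'; have := eta_gap jn.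
rewrite !cantor_baseS b; move: dj; case: (d j) (d' j) => -[] //= _ h1 h2 h3.
  by rewrite ler_normr; apply/orP; left; lra.
by rewrite ler_normr; apply/orP; right; lra.
Qed.

(* Distinct cylinders of level [n] have length [ell n] and disjoint interiors. *)
Lemma cantor_base_gap n d d' : (prefix_val n d <= prefix_val n d')%N ->
  (prefix_val n d' - prefix_val n d)%:R * ell n <= cantor_base n d' - cantor_base n d.
Proof.
elim: n => [|n IH] /=; first by rewrite /cantor_base !big_ord0 mul0r subrr.
rewrite !cantor_baseS; have := ell_half n; have := ell_gt0 n.
move: IH; set z := prefix_val n d; set z' := prefix_val n d'.
set b := d n; set b' := d' n => IH e0 e1 zz.
have le_z : (z <= z')%N by move: zz; case: b b' => [] []; lia.
have {IH} := IH le_z; rewrite !natrB// !natrD -!mul2n !natrM.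
have : z%:R + b%:R <= z'%:R + b'%:R :> R.
  by rewrite -!natrD ler_nat; move: zz le_z; case: b b' => [] []; lia.
nra.
Qed.

(** If the prefixes differed by 2 or more, the left endpoints would be [2 * ell n] apart, and one
    cylinder length can make up only [ell n] of this. Hence a set narrower than [ell n] meets at
    most two neighbouring cylinders. *)
Lemma cantor_point_prefix_close n d d' : `|cantor_point d - cantor_point d'| < ell n ->
  (prefix_val n d' <= prefix_val n d + 1)%N.
Proof.
move=> dd'; rewrite leqNgt; apply/negP => zz.
have := cantor_base_gap (ltnW (leq_ltn_trans (leq_addr 1 _) zz)).
have := cantor_point_bounds n d; have := cantor_point_bounds n d'.
move: dd'; rewrite ltr_norml.
have : 2 <= (prefix_val n d' - prefix_val n d)%:R :> R.
  by rewrite (ler_nat R 2); lia.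
have := ell_gt0 n; nra.
Qed.

End CantorSet.

(** * Lipschitz extension and uniformly convergent series *)

Section Lipschitz.
Variable R : realType.

Definition lipschitz_fun (f : R -> R) :=
  exists2 L, 0 < L & forall x y, `|f x - f y| <= L * `|x - y|.

Lemma lipschitz_sum n (a : nat -> R) (y : nat -> R -> R) :
  (forall k, lipschitz_fun (y k)) ->
  lipschitz_fun (fun x => \sum_(k < n) a k * y k x).
Proof.
move=> ylip; elim: n => [|n [L L0 IH]].
  by exists 1 => // u v; rewrite !big_ord0 subrr normr0 mul1r.
have [M M0 yM] := ylip n.
exists (L + `|a n| * M); first by rewrite ltr_wpDr// mulr_ge0// ltW.
move=> u v; rewrite !big_ord_recr/= opprD addrACA -mulrBr mulrDl.
apply: (le_trans (ler_normD _ _)); apply: lerD => //.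
by rewrite normrM -mulrA ler_wpM2l.
Qed.

Section Bump.
Variables (T : Type) (t0 : T) (X v : T -> R) (h : R).
Hypothesis h0 : 0 < h.
Hypothesis v01 : forall t, 0 <= v t <= 1.

(* The McShane extension of [v], truncated so as to vanish at distance [h]
   from the range of [X]. *)
Definition mcshane_bump (x : R) : R :=
  sup (range (fun t => Num.max 0 (v t - `|x - X t| / h))).

Lemma bump_ub x : ubound (range (fun t => Num.max 0 (v t - `|x - X t| / h))) 1.
Proof.
move=> _ [t _ <-]; rewrite ge_max ler01/=.
have : 0 <= `|x - X t| / h by rewrite divr_ge0// ltW.
by have := v01 t; lra.
Qed.

Lemma bump_ge x t : Num.max 0 (v t - `|x - X t| / h) <= mcshane_bump x.
Proof. by apply: ub_le_sup; [exists 1; exact: bump_ub|exists t]. Qed.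

Lemma bump_le x c : (forall t, Num.max 0 (v t - `|x - X t| / h) <= c) -> mcshane_bump x <= c.
Proof.
by move=> hc; apply: ge_sup => [|_ [t _ <-]//]; exists (Num.max 0 (v t0 - `|x - X t0| / h)), t0.
Qed.

Lemma bump01 x : 0 <= mcshane_bump x <= 1.
Proof.
apply/andP; split; last by apply: bump_le => t; apply: bump_ub; exists t.
by apply: le_trans (bump_ge x t0); rewrite le_max lexx.
Qed.

Lemma bump_lipschitz : lipschitz_fun mcshane_bump.
Proof.
exists h^-1; first by rewrite invr_gt0.
have half x y : mcshane_bump x <= mcshane_bump y + h^-1 * `|x - y|.
  apply: bump_le => t; have := bump_ge y t; have /andP[b0 _] := bump01 y.
  have hi : 0 < h^-1 by rewrite invr_gt0.
  rewrite !ge_max => /andP[_ by_]; apply/andP; split.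
    by rewrite addr_ge0// mulr_ge0// ltW.
  have := ler_distD x y (X t); rewrite (distrC y x) => tri.
  have : h^-1 * `|y - X t| <= h^-1 * (`|x - y| + `|x - X t|) by rewrite ler_pM2l.
  by rewrite mulrDr; move: by_; rewrite [`|y - X t| / h]mulrC [`|x - X t| / h]mulrC; lra.
move=> x y; rewrite ler_norml; have := half x y; have := half y x.
by rewrite (distrC y x); lra.
Qed.

Lemma bump_neq0 x : mcshane_bump x != 0 -> exists t, `|x - X t| < h.
Proof.
move=> bx; apply: contrapT => nex; move: bx; apply/negP; rewrite negbK.
rewrite eq_le (andP (bump01 x)).1 andbT; apply: bump_le => t.
rewrite ge_max lexx/= subr_le0; apply: (@le_trans _ _ 1); first by case/andP: (v01 t).
by rewrite ler_pdivlMr// mul1r leNgt; apply/negP => ?; apply: nex; exists t.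
Qed.

(** A point [t'] with another value is at distance at least [h], where the slope [1 / h] has already
    removed a full unit from [v t' <= 1]; it cannot raise the supremum above [v t]. *)
Lemma bump_val t : (forall t', v t' <> v t -> h <= `|X t' - X t|) -> mcshane_bump (X t) = v t.
Proof.
move=> sep; apply/eqP; rewrite eq_le; apply/andP; split; last first.
  by apply: le_trans (bump_ge _ t); rewrite subrr normr0 mul0r subr0 le_max lexx orbT.
apply: bump_le => t'; rewrite ge_max; case/andP: (v01 t) => -> _ /=.
have := v01 t'; have [->|/eqP/sep] := eqVneq (v t') (v t).
  by rewrite gerBl => _; rewrite divr_ge0// ltW.
rewrite distrC => hs.
have : 1 <= `|X t - X t'| / h by rewrite ler_pdivlMr// mul1r.
by have := v01 t; lra.
Qed.

End Bump.

Section UniformSeries.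
Variables (a : nat -> R) (y : nat -> R -> R).
Hypothesis a_bound : forall k, 0 <= a k <= 2^-1 ^+ k.
Hypothesis y01 : forall k x, 0 <= y k x <= 1.

Let S n x := \sum_(k < n) a k * y k x.

(** The terms are nonnegative, so the supremum of the partial sums is the sum of the series. *)
Definition series_fun (x : R) : R := sup (range (S^~ x)).

Let S_bounds n N x : (n <= N)%N -> S n x <= S N x <= S n x + 2 * (2^-1 ^+ n - 2^-1 ^+ N).
Proof.
move=> /subnKC <-; elim: (N - n)%N => [|k IH]; first by rewrite addn0 subrr mulr0 addr0 lexx.
rewrite addnS {2 3}/S big_ord_recr/= -/(S _ _) exprS.
have := a_bound (n + k); have := y01 (n + k) x; move: IH.
set A := a _; set Y := y _ _; set P := 2^-1 ^+ (n + k) => h1 h2 h3.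
have : 0 <= A * Y by rewrite mulr_ge0; lra.
have : A * Y <= P * 1 by rewrite ler_pM; lra.
lra.
Qed.

Lemma series_fun_approx n x :
  `|series_fun x - \sum_(k < n) a k * y k x| <= 2 * 2^-1 ^+ n.
Proof.
have P0 k : 0 < 2^-1 ^+ k :> R by rewrite exprn_gt0.
have ub : ubound (range (S^~ x)) (S n x + 2 * 2^-1 ^+ n).
  move=> _ [N _ <-]; have := P0 n; have := P0 N.
  have [nN|/ltnW nN] := leqP n N; by have := S_bounds x nN; lra.
have h1 : S n x <= series_fun x by apply: ub_le_sup; [eexists; exact: ub|exists n].
have h2 : series_fun x <= S n x + 2 * 2^-1 ^+ n.
  by apply: ge_sup => //; exists (S 0 x), 0%N.
by rewrite -/(S n x) ler_norml; lra.
Qed.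

Lemma series_fun_finite n x : (forall k, (n <= k)%N -> y k x = 0) ->
  series_fun x = \sum_(k < n) a k * y k x.
Proof.
move=> y0; apply/eqP; rewrite -subr_eq0 -normr_le0 leNgt; apply/negP.
set e := `|_| => e0.
(* Were the difference [e] positive, some partial sum would approximate within less than [e]; but
   from [n] on all partial sums coincide. *)
have [N /(_ N (leqnn N))] := half_power_small 2 e0; apply/negP; rewrite -leNgt.
have [nN|/ltnW Nn] := leqP n N; last first.
  apply: (@le_trans _ _ (2 * 2^-1 ^+ n)); first exact: series_fun_approx.
  rewrite ler_pM2l//; apply: ler_wiXn2l => //; lra.
suff -> : e = `|series_fun x - \sum_(k < N) a k * y k x| by exact: series_fun_approx.
congr (`|_ - _|).
rewrite -(big_mkord xpredT (fun k => a k * y k x)) -[RHS](big_mkord xpredT (fun k => a k * y k x)).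
rewrite [RHS](big_cat_nat (n := n))//= [X in _ + X]big_nat_cond [X in _ + X]big1 ?addr0// => k.
by case/andP => /andP[nk _] _; rewrite y0// mulr0.
Qed.

Hypothesis ylip : forall k, lipschitz_fun (y k).

Lemma series_fun_continuous : continuous series_fun.
Proof.
move=> x; apply/cvgrPdist_lt => e e0.
have e4 : 0 < e / 4 by rewrite divr_gt0.
have [N /(_ N (leqnn N)) Ne] := half_power_small 2 e4.
have [L L0 SL] := lipschitz_sum N a ylip.
near=> z.
have xz : `|x - z| < e / (4 * L).
  near: z; exact: (@nbhsx_ballx _ _ x (e / (4 * L)) ltac:(by rewrite divr_gt0// mulr_gt0)).
have := series_fun_approx N x; have := series_fun_approx N z; have := SL x z.
have : L * `|x - z| < e / 4.
  rewrite mulrC -ltr_pdivlMr//; apply: lt_le_trans xz _.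
  by rewrite invfM mulrA.
by rewrite ltr_norml !ler_norml; lra.
Unshelve. all: by end_near. Qed.

End UniformSeries.
End Lipschitz.

(** * Lower bound for the dimension *)

Section Blocks.
Variable R : realType.
Variables ell eta : nat -> R.
Hypothesis ell0 : ell 0%N = 1.
Hypothesis ell_gt0 : forall n, 0 < ell n.
Hypothesis ell_half : forall n, 2 * ell n.+1 <= ell n.
Hypothesis eta_gt0 : forall n, 0 < eta n.
Hypothesis eta_gap : forall m n, (m <= n)%N -> eta n <= ell m - 2 * ell m.+1.
Variable p : nat -> nat.
Hypothesis p0 : p 0%N = 0%N.
Hypothesis p_double : forall k, ((p k).*2 < p k.+1)%N.
Hypothesis p_fine : forall k, 2^-1 ^+ (p k.+1 - p k) <= ell (p k).
Implicit Types d : nat -> bool.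

Notation cantor_point := (cantor_point ell).

Definition block k d : nat := prefix_val (p k.+1 - p k) (dshift (p k) d).

Definition block_val k d : R := (block k d)%:R / 2 ^+ (p k.+1 - p k).

(** Points whose blocks [k] differ have a differing digit before [p k.+1], hence are [eta (p k.+1)]
    apart. With this width the bump takes exactly the values [block_val k] on the Cantor set. *)
Definition block_fun k : R -> R := mcshane_bump cantor_point (block_val k) (eta (p k.+1)).

Lemma p_lt k : (p k < p k.+1)%N.
Proof. by have := p_double k; lia. Qed.

Lemma p_le : {homo p : k k' / (k <= k')%N}.
Proof. by apply: homo_leq => //; [exact: leq_trans|move=> k; exact: ltnW (p_lt k)]. Qed.

(** Since the positions at least double, [2 ^ k] is at most linear in [p k]: the weight of block [k]
    is only logarithmically small in the scale at which the block starts. *)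
Lemma p_ge k : (2 ^ k <= (p k).+1)%N.
Proof. by elim: k => [|k IH]; rewrite ?p0// expnS; have := p_double k; lia. Qed.

Lemma p_locate n : exists k, (p k <= n < p k.+1)%N.
Proof.
have bnd k : (p k <= n)%N -> (k <= n)%N.
  by move=> /(leq_trans _); apply; have := p_ge k; have := ltn_expl k (leqnn 2); lia.
have ex : exists k, (p k <= n)%N by exists 0%N; rewrite p0.
have [k kn kmax] := ex_maxnP ex bnd; exists k; rewrite kn ltnNge.
by apply/negP => /kmax; rewrite ltnn.
Qed.

Lemma block_val01 k d : 0 <= block_val k d <= 1.
Proof.
rewrite divr_ge0 ?exprn_ge0//= ler_pdivrMr ?exprn_gt0// mul1r.
by rewrite -natrX ler_nat ltnW// prefix_val_lt.
Qed.

Lemma eq_block k d d' : (forall j, (p k <= j < p k.+1)%N -> d j = d' j) ->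
  block k d = block k d'.
Proof. by move=> dd'; apply: eq_prefix_val => j jk; apply: dd'; rewrite /=; lia. Qed.

Lemma block_fun01 k x : 0 <= block_fun k x <= 1.
Proof. by apply: (bump01 (fun=> false)); [exact: eta_gt0|exact: block_val01]. Qed.

Lemma block_fun_lipschitz k : lipschitz_fun (block_fun k).
Proof. by apply: (bump_lipschitz (fun=> false)); [exact: eta_gt0|exact: block_val01]. Qed.

Lemma block_fun_neq0 k x : block_fun k x != 0 ->
  exists d, `|x - cantor_point d| < eta (p k.+1).
Proof. by apply: (bump_neq0 (fun=> false)); [exact: eta_gt0|exact: block_val01]. Qed.

Lemma block_fun_cantor_point k d : block_fun k (cantor_point d) = block_val k d.
Proof.
apply: (bump_val (fun=> false)); [exact: eta_gt0|exact: block_val01|].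
move=> d' dd'; apply: (cantor_point_sep ell_gt0 ell_half eta_gap).
apply: contrapT => nex; apply: dd'; congr (_%:R / _).
apply: eq_block => j /andP[_ jk]; apply/eqP; apply: contrapT => /negP jj.
by apply: nex; exists j => //; exact: ltnW.
Qed.

Section LowerBound.
Variables (C : nat -> R) (w V : R -> R) (W T A : R) (m : nat).
Hypothesis W0 : 0 <= W.
Hypothesis A0 : 0 < A.
Hypothesis V_approx : forall n d,
  `|V (cantor_point d) - \sum_(k < n) C k * block_val k d| <= T * 2^-1 ^+ n.
Hypothesis w_osc : forall k d d', (forall j, (j < p k.+1)%N -> d j = d' j) ->
  `|w (cantor_point d) - w (cantor_point d')| <= W * ell (p k).
Hypothesis C_large : forall k, exists k',
  [/\ (k.+2 <= k')%N, (k' <= k.+1 + m)%N & A * 2^-1 ^+ k' <= `|C k'|].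

Let P d : R * R := (cantor_point d, w (cantor_point d) + V (cantor_point d)).

(** The heights differ by at most [r], the [w] parts by [W * r], and the two tails of [V] beyond
    block [n2] contribute [r] each. Only block [k] varies among the first [n2], so its weighted
    change is at most [(3 + W) * r]. *)
Lemma block_spread n2 k (U : set (R * R)) (r : R) d d' :
  (k < n2)%N -> A * 2^-1 ^+ k <= `|C k| -> ell (p k.-1) <= r -> (0 < k)%N ->
  T * 2^-1 ^+ n2 <= r ->
  (forall x y, U x -> U y -> edist2 x y <= r) -> U (P d) -> U (P d') ->
  (forall j, (j < p k)%N -> d j = d' j) ->
  (forall j, (p k.+1 <= j < p n2)%N -> d j = d' j) ->
  `|(block k d)%:R - (block k d')%:R| <=
    (3 + W) / A * (r * 2 ^+ (p k.+1 - p k) * 2 ^+ k).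
Proof.
move=> kn Ck lr k0 Tr Ur Ud Ud' pre suf.
have hU : `|w (cantor_point d) + V (cantor_point d) - (w (cantor_point d') + V (cantor_point d'))| <= r.
  exact: le_trans (edist2_ley _ _) (Ur _ _ Ud Ud').
have hw : `|w (cantor_point d) - w (cantor_point d')| <= W * r.
  apply: le_trans (_ : W * ell (p k.-1) <= _); last by rewrite ler_wpM2l.
  (* The oscillation bound is used at [k.-1], because block [k] starts at the end of block
     [k.-1]. *)
  by apply: w_osc => j jk; apply: pre; rewrite prednK in jk.
have sumE : \sum_(j < n2) C j * block_val j d - \sum_(j < n2) C j * block_val j d'
    = C k * (block_val k d - block_val k d').
  rewrite -sumrB (bigD1 (Ordinal kn))//= -mulrBr big1 ?addr0// => j jk.
  apply/eqP; rewrite -mulrBr mulf_eq0 subr_eq0; apply/orP; right; apply/eqP.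
  congr (_%:R / _); apply: eq_block => i /andP[i1 i2].
  have [jk'|kj|jk'] := ltngtP (j : nat) k.
  - by apply: pre; apply: leq_trans i2 _; exact: p_le.
  - by apply: suf; rewrite (leq_trans _ i1) ?p_le//= (leq_trans i2)// p_le.
  - by case/eqP: jk; apply: val_inj.
have hV : `|C k * (block_val k d - block_val k d')| <= (3 + W) * r.
  rewrite -sumE; have := V_approx n2 d; have := V_approx n2 d'.
  move: hU hw; rewrite !ler_norml; lra.
have P2 : 0 < (2 : R) ^+ (p k.+1 - p k) by rewrite exprn_gt0.
have P3 : 0 < (2 : R) ^+ k by rewrite exprn_gt0.
move: hV; rewrite normrM /block_val -mulrBl normrM [`|_^-1|]ger0_norm ?invr_ge0 ?(ltW P2)//.
rewrite mulrA ler_pdivrMr// => hV.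
have : A * 2^-1 ^+ k * `|(block k d)%:R - (block k d')%:R| <= (3 + W) * r * 2 ^+ (p k.+1 - p k).
  by apply: le_trans hV; rewrite ler_wpM2r.
move=> h; rewrite -(ler_pM2l (x := A * 2^-1 ^+ k)) ?mulr_gt0 ?exprn_gt0//.
apply: (le_trans h); rewrite exprVn le_eqVlt; apply/orP; left; apply/eqP.
by field; rewrite !gt_eqF.
Qed.

Lemma spread_bound_ge0 (r : R) a b :
  0 <= r -> 0 <= (3 + W) / A * (r * 2 ^+ a * 2 ^+ b).
Proof.
move=> r0; apply: mulr_ge0; last by rewrite !mulr_ge0 ?exprn_ge0.
by apply: divr_ge0; [have := W0; lra|exact: ltW].
Qed.

(** A prefix of length [L] is cut into its first [n] digits, the digits up to block [k'], block [k']
    itself, and the rest. A set of diameter [r] allows two values of the first piece and about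
    [r * 2 ^ q * 2 ^ k'] of the third; the other two are left free. *)
Lemma hits_count : exists2 K, 0 < K & forall n r (U : set (R * R)),
  ell n.+1 <= r < ell n -> (forall x y, U x -> U y -> edist2 x y <= r) ->
  exists (L : nat) (S : seq nat),
    (forall d, U (P d) -> prefix_val L d \in S) /\
    (size S)%:R <= K * (n.+1%:R * r / 2 ^+ n) * 2 ^+ L.
Proof.
(* The added 1 absorbs the rounding up of the number of block values. *)
pose B := (3 + W) / A + 1.
have B0 : 0 < B.
  have q0 : 0 < (3 + W) / A by apply: divr_gt0 => //; have := W0; lra.
  exact: addr_gt0.
(* The 2 counts the cylinders of level [n], and the power of 2 comes from
   [2 ^ k' <= 2 ^ m.+1 * n.+1]. *)
exists (2 * 2 ^+ m.+1 * B); first by rewrite mulr_gt0// mulr_gt0// exprn_gt0.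
move=> n r U /andP[nr rn] Ur.
have r0 : 0 < r := lt_le_trans (ell_gt0 _) nr.
have [k /andP[pkn npk]] := p_locate n.
have [k' [kk' k'm Ck']] := C_large k.
have k'0 : (0 < k')%N by apply: leq_trans kk'.
(* As [k'] is at least [k.+2], block [k'.-1] starts after digit [n]; hence [w] varies by at most
   [W * r] once the digits before block [k'] are fixed. *)
have lr : ell (p k'.-1) <= r.
  apply: le_trans nr; apply: (ell_le ell_gt0 ell_half).
  by apply: (leq_trans npk); apply: p_le; lia.
(* The series for [V] is cut where its tail is below [r]; [L] is then the end of a whole block. *)
have [n2 kn2 Tn2] : exists2 n2, (k' < n2)%N & T * 2^-1 ^+ n2 <= r.
  have [N HN] := half_power_small T r0.
  by exists (maxn N k'.+1); [rewrite leq_max leqnn orbT|rewrite ltW// HN// leq_maxl].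
pose Pk := p k'; pose q := (p k'.+1 - p k')%N; pose L := p n2; pose g := (L - p k'.+1)%N.
have npP : (n <= Pk)%N by apply: (leq_trans (ltnW npk)); apply: p_le; lia.
have LE : L = (Pk + q + g)%N.
  by rewrite /L /Pk /q /g; have := p_le kn2; have := p_lt k'; lia.
have LE' : L = (p k'.+1 + g)%N by rewrite /L /g; have := p_le kn2; lia.
pose S := [seq z <- iota 0 (2 ^ L) | `[< exists2 d, prefix_val L d = z & U (P d) >]].
have SP z : z \in S -> exists2 d, prefix_val L d = z & U (P d).
  by rewrite mem_filter => /andP[/asboolP].
have uS : uniq S by rewrite filter_uniq ?iota_uniq.
exists L, S; split.
  move=> d Ud; rewrite mem_filter mem_iota leq0n add0n prefix_val_lt !andbT.
  by apply/asboolP; exists d.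
(* [f1], [f2] and [f3] read off every digit of the prefix except those of block [k']. *)
pose f1 z := (z %/ 2 ^ (L - n))%N.
pose f2 z := ((z %/ 2 ^ (L - Pk)) %% 2 ^ (Pk - n))%N.
pose f3 z := (z %% 2 ^ g)%N.
have f1E d : f1 (prefix_val L d) = prefix_val n d.
  by rewrite /f1 -[in prefix_val L d](subnKC (_ : n <= L)%N) ?prefix_val_divn//; lia.
have fPE d : (prefix_val L d %/ 2 ^ (L - Pk))%N = prefix_val Pk d.
  by rewrite -[in prefix_val L d](subnKC (_ : Pk <= L)%N) ?prefix_val_divn//; lia.
have f3E d : f3 (prefix_val L d) = prefix_val g (dshift (p k'.+1) d).
  rewrite /f3 -[in prefix_val L d](subnKC (_ : p k'.+1 <= L)%N); last exact: p_le.
  by rewrite prefix_val_modn.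
pose t1 := undup [seq f1 z | z <- S].
have st1 : (size t1 <= 2)%N.
  apply: size_spread => [|x y]; first exact: undup_uniq.
  rewrite !mem_undup => /mapP[z /SP[d <- Ud] ->] /mapP[z' /SP[d' <- Ud'] ->].
  rewrite !f1E; apply: (cantor_point_prefix_close ell_gt0 ell_half).
  exact: le_lt_trans (le_trans (edist2_lex _ _) (Ur _ _ Ud' Ud)) rn.
pose t := [seq (ab, c) | ab <- [seq (a, b) | a <- t1, b <- iota 0 (2 ^ (Pk - n))],
                         c <- iota 0 (2 ^ g)].
pose D := (3 + W) / A * (r * 2 ^+ q * 2 ^+ k').
(* On a fibre of the three maps only block [k'] varies, so its value [h] is injective there, and
   [block_spread] confines it to a range of length [D]. *)
have fibS y : (size [seq z <- S | (f1 z, f2 z, f3 z) == y] <= (Num.truncn D).+1)%N.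
  case: y => [[y1 y2] y3].
  pose h z := ((z %/ 2 ^ g) %% 2 ^ q)%N.
  have hE d : h (prefix_val L d) = block k' d.
    rewrite /h LE'.
    rewrite prefix_val_divn -[in prefix_val _ d](subnKC (ltnW (p_lt k'))).
    by rewrite prefix_val_modn.
  set s := [seq z <- S | _].
  have same d d' : U (P d) -> U (P d') -> prefix_val L d \in s -> prefix_val L d' \in s ->
      (forall j, (j < Pk)%N -> d j = d' j) /\
      (forall j, (p k'.+1 <= j < L)%N -> d j = d' j).
    move=> Ud Ud'; rewrite !mem_filter => /andP[/eqP[e1 e2 e3] _] /andP[/eqP[e1' e2' e3'] _].
    split=> j.
      apply: prefix_val_inj; rewrite -!fPE.
      rewrite (divn_eq (_ %/ _) (2 ^ (Pk - n))) [RHS](divn_eq _ (2 ^ (Pk - n))).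
      rewrite -/(f2 _) e2 -/(f2 _) e2' !fPE.
      rewrite -[in prefix_val Pk d](subnKC npP) -[in prefix_val Pk d'](subnKC npP).
      by rewrite !prefix_val_divn -!f1E e1 e1'.
    move=> /andP[j1 j2].
    have /prefix_val_inj/(_ (j - p k'.+1)%N) : prefix_val g (dshift (p k'.+1) d)
        = prefix_val g (dshift (p k'.+1) d') by rewrite -!f3E e3 e3'.
    rewrite /dshift subnKC//; apply.
    exact: (ltn_sub2r (leq_ltn_trans j1 j2) j2).
  have us : uniq s by rewrite filter_uniq.
  have sS z : z \in s -> z \in S by rewrite mem_filter => /andP[].
  have hinj : {in s &, injective h}.
    move=> z z' zs z's; have [d dz Ud] := SP _ (sS _ zs); have [d' dz' Ud'] := SP _ (sS _ z's).
    subst z z'; rewrite !hE => bb.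
    have [same1 same2] := same _ _ Ud Ud' zs z's.
    apply: eq_prefix_val => j jL.
    have [jP|Pj] := ltnP j Pk; first exact: same1.
    have [jP'|Pj'] := ltnP j (p k'.+1); last by apply: same2; rewrite Pj'.
    have := prefix_val_inj bb (j := (j - p k')%N).
    rewrite /dshift subnKC//; apply.
    exact: (ltn_sub2r (leq_ltn_trans Pj jP') jP').
  rewrite -(size_map h); apply: size_spread; first by rewrite map_inj_in_uniq.
  move=> _ _ /mapP[z zs ->] /mapP[z' z's ->].
  have [d dz Ud] := SP _ (sS _ zs); have [d' dz' Ud'] := SP _ (sS _ z's).
  subst z z'; rewrite !hE.
  have [same1 same2] := same _ _ Ud Ud' zs z's.
  rewrite -leq_subLR; have [bb|/ltnW bb] := leqP (block k' d') (block k' d); last first.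
    by rewrite (eqP (_ : (block k' d - block k' d' == 0)%N)).
  rewrite truncn_ge_nat ?natrB//; last by rewrite spread_bound_ge0// ltW.
  apply: le_trans (ler_norm _) _.
  exact: (block_spread kn2 Ck' lr k'0 Tn2 Ur Ud Ud' same1 same2).
have tS z : z \in S -> (f1 z, f2 z, f3 z) \in t.
  move=> zS; apply/allpairsP; exists ((f1 z, f2 z), f3 z); split => //=.
    apply/allpairsP; exists (f1 z, f2 z); split => //=.
      by rewrite mem_undup; apply/mapP; exists z.
    by rewrite mem_iota /= ltn_mod expn_gt0.
  by rewrite mem_iota /= ltn_mod expn_gt0.
have := size_fibers uS tS fibS; rewrite /t !size_allpairs !size_iota => szS.
have P2 a : 0 < (2 : R) ^+ a by rewrite exprn_gt0.
(* This is where [p_fine] enters: the block is long enough to resolve values finer than [r]. *)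
have rq : 1 <= r * 2 ^+ q.
  rewrite -(ler_pdivrMr _ _ (P2 q)) mul1r -exprVn; apply: le_trans lr.
  apply: le_trans (p_fine k') _; apply: (ell_le ell_gt0 ell_half); apply: p_le; lia.
have DB : (Num.truncn D).+1%:R <= B * (r * 2 ^+ q * 2 ^+ k').
  rewrite -natr1 mulrDl mul1r; apply: lerD; first by rewrite truncn_le spread_bound_ge0// ltW.
  by rewrite -[leLHS]mulr1; apply: ler_pM => //; rewrite exprn_ege1// ler1n.
have k'n : 2 ^+ k' <= 2 ^+ m.+1 * n.+1%:R :> R.
  apply: (@le_trans _ _ (2 ^+ (k.+1 + m))); first by rewrite ler_eXn2l// ltr1n.
  rewrite addSnnS addnC exprD ler_pM2l// -natrX ler_nat.
  by apply: leq_trans (p_ge k) _.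
apply: (@le_trans _ _ ((2 * 2 ^ (Pk - n) * 2 ^ g)%:R * (B * (r * 2 ^+ q * 2 ^+ k')))).
  apply: (@le_trans _ _ ((2 * 2 ^ (Pk - n) * 2 ^ g)%:R * (Num.truncn D).+1%:R)).
    by rewrite -natrM ler_nat (leq_trans szS)// !leq_mul.
  by rewrite ler_wpM2l.
rewrite !natrM !natrX.
have -> : 2 ^+ L = 2 ^+ (Pk - n) * 2 ^+ n * 2 ^+ q * 2 ^+ g :> R.
  by rewrite LE -!exprD subnK.
have -> : 2 * 2 ^+ (Pk - n) * 2 ^+ g * (B * (r * 2 ^+ q * 2 ^+ k')) =
   (2 * 2 ^+ (Pk - n) * 2 ^+ g * B * r * 2 ^+ q) * 2 ^+ k' :> R by ring.
have -> : 2 * 2 ^+ m.+1 * B * (n.+1%:R * r / 2 ^+ n) * (2 ^+ (Pk - n) * 2 ^+ n * 2 ^+ q * 2 ^+ g)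
  = (2 * 2 ^+ (Pk - n) * 2 ^+ g * B * r * 2 ^+ q) * (2 ^+ m.+1 * n.+1%:R).
  by field; rewrite gt_eqF.
by rewrite ler_pM2l// !mulr_gt0.
Qed.

Lemma ell_locate (r : R) : 0 < r < 1 -> exists n, ell n.+1 <= r < ell n.
Proof.
move=> /andP[r0 r1].
have ex : exists n, ell n <= r.
  have [N /(_ N (leqnn N))] := half_power_small 1 r0; rewrite mul1r => /ltW h.
  by exists N; apply: le_trans h; apply: (ell_le_half ell0 ell_half).
have [n nr nmin] := ex_minnP ex.
case: n nr nmin => [|n nr nmin]; first by rewrite ell0; lra.
by exists n; rewrite nr ltNge; apply/negP => /nmin; rewrite ltnn.
Qed.

(** A covering set of diameter [r i] captures a proportion of at most [K * K' * r i ^ t] of the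
    digit sequences; a cover of small total would capture at most half of [0, 1). *)
Lemma graph_not_hnull (t K' : R) (h : R -> R) : 1 <= t -> 0 < K' ->
  (forall n, n.+1%:R / 2 ^+ n <= K' * ell n.+1 `^ (t - 1)) ->
  (forall x, 0 <= x <= 1 -> h x = w x + V x) ->
  ~ hnull t (graph h `[0, 1]).
Proof.
move=> t1 K'0 HK' hE; have t0 : 0 < t by lra.
have [K K0 HK] := hits_count => /(hnull_pos t0).
have e0 : 0 < (2 * (K * K'))^-1 by rewrite invr_gt0 !mulr_gt0.
(* Radii at most 1/2 are below [ell 0 = 1], so each falls between two consecutive lengths; the
   chosen total makes the captured mass at most 1/2. *)
move=> /(_ _ 2^-1 e0 ltac:(lra))[U [r [gU rd Ur rt]]].
have /choice[LS HLS] : forall i, exists LS : nat * seq nat,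
   (forall d, U i (P d) -> prefix_val LS.1 d \in LS.2) /\
    (size LS.2)%:R <= K * K' * r i `^ t * 2 ^+ LS.1.
  move=> i; have /andP[r0 rle] := rd i.
  have [|n nr] := @ell_locate (r i); first by lra.
  have [L [S [h1 h2]]] := HK n (r i) (U i) nr (Ur i).
  exists (L, S); split => //; apply: (le_trans h2).
  rewrite ler_pM2r ?exprn_gt0//.
  have -> : r i `^ t = r i * r i `^ (t - 1) by rewrite mulr_powRB1// ltW.
  rewrite [leLHS](_ : _ = (K * r i) * (n.+1%:R / 2 ^+ n)); last by ring.
  rewrite [leRHS](_ : _ = (K * r i) * (K' * r i `^ (t - 1))); last by ring.
  rewrite ler_pM2l ?mulr_gt0//; apply: (le_trans (HK' n)); rewrite ler_pM2l//.
  apply: ge0_ler_powR; rewrite ?nnegrE ?(ltW r0) ?(ltW (ell_gt0 _))//; first by lra.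
  by case/andP: nr.
have := @digits_cover R (fun i => (LS i).1) (fun i => (LS i).2)
  (fun i => K * K' * r i `^ t) 2^-1.
have h1 (u : R) : 0 <= u < 1 -> exists i, prefix_val (LS i).1 (digits u) \in (LS i).2.
  move=> _; have c01 := cantor_point01 ell0 ell_gt0 ell_half (digits u).
  have [i _ Ui] : (\bigcup_i U i) (P (digits u)).
    apply: gU; exists (cantor_point (digits u)); first by rewrite /= in_itv.
    by rewrite hE.
  by exists i; apply: (HLS i).1.
move=> /(_ h1 (fun i => (HLS i).2)) h2.
suff : 1 <= 2^-1 :> R by lra.
apply: h2 => N; rewrite -mulr_sumr.
apply: (@le_trans _ _ (K * K' * (2 * (K * K'))^-1)); first by rewrite ler_pM2l ?mulr_gt0.
by rewrite le_eqVlt; apply/orP; left; apply/eqP; field; rewrite !gt_eqF.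
Qed.

End LowerBound.
End Blocks.

(** * Upper bound for the dimension *)

Lemma powR_gt1 (R : realType) (a x : R) : 1 < a -> 0 < x -> 1 < a `^ x.
Proof.
move=> a1 x0; have <- : 1 `^ x = 1 :> R by rewrite powR1.
apply: gt0_ltr_powR => //; rewrite nnegrE ?ler01// ltW// (lt_trans _ a1)//.
Qed.

Lemma powR_exprn (R : realType) (a x : R) n :
  0 <= a -> (a ^+ n) `^ x = (a `^ x) ^+ n.
Proof. by move=> a0; rewrite -!powR_mulrn ?powR_ge0// -!powRrM mulrC. Qed.

(** * The cylinder lengths and their growth rates *)

Section Scales.
Variables (R : realType) (s : R).
Hypothesis s12 : 1 < s <= 2.

(** The solution of [2 * ratio ^ (s - 1) = 1]: the contraction ratio of the two-piece Cantor set of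
    dimension [s - 1]. *)
Definition ratio : R := 2 `^ (- (s - 1)^-1).

(** The divisor keeps the gaps open even for [s = 2], where the ratio is 1/2, and being polynomial
    it does not change the dimension. *)
Definition scale n : R := ratio ^+ n / n.+1%:R.

Definition gap n : R := ratio ^+ n / (n.+1%:R * n.+2%:R).

Lemma ratio_gt0 : 0 < ratio. Proof. exact: powR_gt0. Qed.

Lemma ratio_le_half : ratio <= 2^-1.
Proof.
rewrite /ratio -(powR_inv1 (ler0n _ 2)); apply: ler_powR; first by rewrite ler1n.
have s1 : 0 < s - 1 by move: s12; lra.
by rewrite lerN2 invf_ge1//; move: s12; lra.
Qed.

Lemma scale0 : scale 0 = 1. Proof. by rewrite /scale expr0 divr1. Qed.

Lemma scale_gt0 n : 0 < scale n.
Proof. by rewrite divr_gt0 ?exprn_gt0 ?ratio_gt0. Qed.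

Lemma gap_gt0 n : 0 < gap n.
Proof. by rewrite divr_gt0 ?exprn_gt0 ?ratio_gt0 ?mulr_gt0. Qed.

(** Over the common denominator the numerator is [m.+2 - 2 * ratio * m.+1], at least 1 because the
    ratio is at most 1/2. *)
Lemma scale_gapS m : gap m <= scale m - 2 * scale m.+1.
Proof.
rewrite /scale /gap exprS; have r0 := ratio_gt0; have rh := ratio_le_half.
have P0 : 0 < ratio ^+ m by rewrite exprn_gt0.
have m1 : 0 < m.+1%:R :> R by []. have m2 : 0 < m.+2%:R :> R by [].
have -> : ratio ^+ m / m.+1%:R - 2 * (ratio * ratio ^+ m / m.+2%:R) =
   ratio ^+ m * (m.+2%:R - 2 * ratio * m.+1%:R) / (m.+1%:R * m.+2%:R).
  by field; rewrite !gt_eqF.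
rewrite ler_pM2r ?invr_gt0 ?mulr_gt0// -[leLHS]mulr1 ler_pM2l//.
by rewrite -(natr1 m.+1); nra.
Qed.

Lemma gap_antitone m n : (m <= n)%N -> gap n <= gap m.
Proof.
move=> mn; have r0 := ratio_gt0; have rh := ratio_le_half; apply: ler_pM.
- by rewrite exprn_ge0// ltW.
- by rewrite invr_ge0 mulr_ge0.
- by apply: ler_wiXn2l => //; lra.
- by rewrite lef_pV2 ?posrE ?mulr_gt0// -!natrM ler_nat leq_mul.
Qed.

Lemma scale_gap m n : (m <= n)%N -> gap n <= scale m - 2 * scale m.+1.
Proof. by move=> /gap_antitone h; exact: le_trans h (scale_gapS m). Qed.

Lemma scale_half n : 2 * scale n.+1 <= scale n.
Proof. by have := scale_gapS n; have := gap_gt0 n; lra. Qed.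

Lemma scale_powR_small t eps : s < t -> 0 < eps ->
  exists N, forall n, (N <= n)%N -> 2 ^+ n * scale n `^ (t - 1) <= eps.
Proof.
move=> st e0; have r0 := ratio_gt0.
(* For [t > s] this number is below 1 by the choice of the ratio, so the bound decays
   geometrically. *)
pose z := 2 * ratio `^ (t - 1).
have z0 : 0 <= z by rewrite mulr_ge0// powR_ge0.
have z1 : z < 1.
  have s1 : 0 < s - 1 by move: s12; lra.
  have : 1 < 2 `^ ((s - 1)^-1 * (t - 1) - 1) :> R.
    by rewrite powR_gt1 ?ltr1n// subr_gt0 mulrC ltr_pdivlMr//; lra.
  rewrite powRD; last by rewrite pnatr_eq0 implybT.
  rewrite powR_inv1// /z /ratio -powRrM mulNr powRN.
  set y := 2 `^ _ => y1; have y0 : 0 < y by rewrite powR_gt0.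
  by rewrite ltr_pdivrMr// mul1r; lra.
have z01 : 0 <= z < 1 by rewrite z0.
have [N HN] := geometric_small 1 z01 e0.
exists N => n /HN; rewrite mul1r => /ltW; apply: le_trans.
rewrite exprMn ler_pM2l ?exprn_gt0//.
apply: (@le_trans _ _ ((ratio ^+ n) `^ (t - 1))).
  apply: ge0_ler_powR; rewrite ?nnegrE ?exprn_ge0 ?(ltW r0) ?(ltW (scale_gt0 _))//; first by move: s12; lra.
  by rewrite ler_pdivrMr// ler_peMr ?exprn_ge0 ?(ltW r0)// ler1n.
by rewrite powR_exprn// ltW.
Qed.

(** From [exp y >= 1 + y ^ 2 / 2] at [y = n * ln x]. *)
Lemma quadratic_le_geometric (x : R) : 1 < x ->
  exists2 K, 0 < K & forall n, n.+1%:R * n.+2%:R <= K * x ^+ n.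
Proof.
move=> x1; have l0 : 0 < ln x by rewrite ln_gt0.
exists (6 + 12 / ln x ^+ 2); first by rewrite addr_gt0// divr_gt0// exprn_gt0.
move=> n; have := @expR_ge1Dxn R (ln x * n%:R) 1.
rewrite mulr_ge0 ?(ltW l0)// => /(_ isT).
rewrite expRM_natr lnK ?posrE; last by lra.
rewrite exprMn; set y := ln x ^+ 2; set z := n%:R => h.
have y0 : 0 < y by rewrite exprn_gt0.
apply: (@le_trans _ _ ((6 + 12 / y) * (1 + y * z ^+ 2 / 2))); last first.
  by rewrite ler_pM2l// addr_gt0// divr_gt0.
have -> : (6 + 12 / y) * (1 + y * z ^+ 2 / 2) = 6 + 12 / y + 3 * y * z ^+ 2 + 6 * z ^+ 2.
  by field; rewrite gt_eqF.
have : 0 < 12 / y by rewrite divr_gt0.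
have : 0 <= 3 * y * z ^+ 2 by rewrite mulr_ge0 ?sqr_ge0// mulr_ge0// ltW.
have := sqr_ge0 (z - 1); rewrite -(natr1 n.+1) -(natr1 n) -/z.
by move: (12 / y) (3 * y * z ^+ 2) => a b; have := sqr_ge0 z; lra.
Qed.

(** For [t < s] the number [2 * mu] exceeds 1, and its powers beat the polynomial factors. *)
Lemma scale_powR_large t : 1 <= t < s ->
  exists2 K, 0 < K & forall n, n.+1%:R / 2 ^+ n <= K * scale n.+1 `^ (t - 1).
Proof.
move=> /andP[t1 ts]; have r0 := ratio_gt0.
pose mu := ratio `^ (t - 1).
have mu0 : 0 < mu by rewrite powR_gt0.
have mu2 : 1 < 2 * mu.
  have s1 : 0 < s - 1 by move: s12; lra.
  have : 1 < 2 `^ (1 - (s - 1)^-1 * (t - 1)) :> R.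
    by rewrite powR_gt1 ?ltr1n// subr_gt0 mulrC ltr_pdivrMr//; lra.
  rewrite powRD; last by rewrite pnatr_eq0 implybT.
  by rewrite powRr1// /mu /ratio -powRrM mulNr.
have [K K0 HK] := quadratic_le_geometric mu2.
exists (K / mu); first by rewrite divr_gt0.
move=> n; apply: (@le_trans _ _ (K / mu * (mu ^+ n.+1 / n.+2%:R))); last first.
  rewrite ler_pM2l ?divr_gt0// /scale powRM ?invr_ge0 ?exprn_ge0 ?(ltW r0)//.
  apply: ler_pM; rewrite ?invr_ge0 ?exprn_ge0 ?(ltW mu0)//.
    by rewrite powR_exprn// ltW.
  (* The base is at most 1 and the exponent [t - 1] is at most 1, so the power is no smaller than
     the base. *)
  apply: ger1_powR; last by move: s12; lra.
  by rewrite invr_gt0 ltr0n/= invf_le1// ler1n.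
rewrite ler_pdivrMr ?exprn_gt0// exprS.
have -> : K / mu * (mu * mu ^+ n / n.+2%:R) * 2 ^+ n = (K * (2 * mu) ^+ n) / n.+2%:R.
  by rewrite exprMn; field; rewrite !gt_eqF.
by rewrite ler_pdivlMr.
Qed.

End Scales.

(** * Covering the graph over and off the closure of the Cantor set *)

Section UpperBound.
Variable R : realType.
Variables ell eta : nat -> R.
Hypothesis ell0 : ell 0%N = 1.
Hypothesis ell_gt0 : forall n, 0 < ell n.
Hypothesis ell_half : forall n, 2 * ell n.+1 <= ell n.
Hypothesis eta_gt0 : forall n, 0 < eta n.
Hypothesis eta_gap : forall m n, (m <= n)%N -> eta n <= ell m - 2 * ell m.+1.
Variable p : nat -> nat.
Hypothesis p0 : p 0%N = 0%N.
Hypothesis p_double : forall k, ((p k).*2 < p k.+1)%N.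

Notation cantor_point := (cantor_point ell).
Notation block_fun := (block_fun ell eta p).
Notation block_fun_lip := (block_fun_lipschitz ell eta_gt0 p).

(** Holding for every [n] means lying in the closure of the Cantor set. *)
Let near_cantor n (x : R) := exists d, `|x - cantor_point d| <= ell n.

Lemma block_fun_near k n x : (n <= k)%N -> block_fun k x != 0 -> near_cantor n x.
Proof.
move=> nk /(block_fun_neq0 eta_gt0)[d xd]; exists d; apply: le_trans (ltW xd) _.
apply: (@le_trans _ _ (ell (p k.+1))).
  by have := eta_gap (leqnn (p k.+1)); have := ell_gt0 (p k.+1).+1; lra.
apply: (ell_le ell_gt0 ell_half); apply: leq_trans nk _.
by have := p_ge p0 p_double k.+1; have := ltn_expl k.+1 (leqnn 2); lia.
Qed.

(** Over each of the [2 ^ n] cylinders, about [2 * B / ell n] boxes of size comparable to [ell n]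
    suffice, whatever [h] is; the total is of order [2 ^ n * ell n ^ (t - 1)]. *)
Lemma cantor_graph_hnull (t B : R) (h : R -> R) : 1 < t -> 0 <= B ->
  (forall x, 0 <= x <= 1 -> `|h x| <= B) ->
  (forall eps, 0 < eps -> exists N, forall n, (N <= n)%N ->
     2 ^+ n * ell n `^ (t - 1) <= eps) ->
  hnull t (graph h [set x | 0 <= x <= 1 /\ forall n, near_cantor n x]).
Proof.
move=> t1 B0 hB small; have t0 : 0 < t by lra.
apply: hnull_finite => // eps del e0 d0.
have c0 : 0 < 4 `^ t * (2 * B + 1) by rewrite mulr_gt0 ?powR_gt0//; lra.
have [N1 HN1] := small _ (divr_gt0 e0 c0).
have [N2 HN2] : exists N, forall n, (N <= n)%N -> 4 * ell n <= del.
  have [N HN] := half_power_small 4 d0; exists N => n /HN/ltW; apply: le_trans.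
  by rewrite ler_pM2l// (ell_le_half ell0 ell_half).
pose n := maxn N1 N2; have ln0 := ell_gt0 n.
have ln1 : ell n <= 1 by rewrite -ell0; exact: (ell_le ell_gt0 ell_half).
pose N := (Num.truncn (2 * B / ell n)).+1.
(* The index encodes a pair: its quotient by [N] is the cylinder, its remainder the vertical slot.
   Points of one box differ by at most [3 * ell n] across and [ell n] in height. *)
exists (2 ^ n * N)%N, (4 * ell n), (fun i => [set q | exists d,
  [/\ prefix_val n d = (i %/ N)%N, `|q.1 - cantor_point d| <= ell n,
      - B <= q.2 & Num.truncn ((q.2 + B) / ell n) = (i %% N)%N]]).
split.
- by rewrite mulr_ge0 ?(ltW ln0)//= HN2// leq_maxr.
- have Nl : N%:R * ell n <= 2 * B + 1.
    rewrite /N -natr1 mulrDl mul1r; apply: lerD => //.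
    rewrite -ler_pdivlMr// truncn_le divr_ge0 ?mulr_ge0 ?(ltW ln0)//.
  have := HN1 n (leq_maxl _ _); rewrite ler_pdivlMr// => h1; apply: le_trans h1.
  rewrite natrM natrX powRM ?(ltW ln0)// -(mulr_powRB1 (ltW ln0) t0).
  rewrite [leLHS](_ : _ = 2 ^+ n * ell n `^ (t - 1) * (4 `^ t * (N%:R * ell n))); last by ring.
  by rewrite ler_pM2l ?mulr_gt0 ?exprn_gt0 ?powR_gt0// ler_pM2l ?powR_gt0.
- move=> _ [x [x01 /(_ n)[d xd]] <-]; have /ler_normlP[hx1 hx2] := hB x x01.
  have hx0 : 0 <= (h x + B) / ell n by rewrite divr_ge0 ?(ltW ln0)//; lra.
  have cN : (Num.truncn ((h x + B) / ell n) < N)%N.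
    rewrite ltnS truncn_ge_nat; last by rewrite divr_ge0 ?mulr_ge0 ?(ltW ln0).
    apply: le_trans (_ : (h x + B) / ell n <= _); first by rewrite truncn_le.
    by rewrite ler_pM2r ?invr_gt0//; lra.
  exists (prefix_val n d * N + Num.truncn ((h x + B) / ell n))%N.
    have := prefix_val_lt n d; set a := prefix_val n d; set b := Num.truncn _ in cN * => aM.
    by apply: (@leq_trans (a.+1 * N)); [rewrite mulSn addnC ltn_add2r|rewrite leq_mul].
  exists d; rewrite divnMDl// divn_small// addn0 modnMDl modn_small//.
  by split => //=; lra.
- move=> i [x y] [x' y'] [d [/= d1 xd yB yt]] [d' [/= d1' xd' yB' yt']].
  apply: le_trans (edist2_le _ _) _ => /=.
  have : `|cantor_point d - cantor_point d'| <= ell n.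
    apply: (cantor_point_near ell_gt0 ell_half) => j jn.
    by apply: (prefix_val_inj _ jn); rewrite d1.
  have yy : `|y - y'| <= ell n.
    have h1 : 0 <= (y + B) / ell n by rewrite divr_ge0 ?(ltW ln0)//; lra.
    have h2 : 0 <= (y' + B) / ell n by rewrite divr_ge0 ?(ltW ln0)//; lra.
    have := truncn_itv h1; have := truncn_itv h2; rewrite yt yt' -natr1.
    rewrite ler_pdivlMr// ltr_pdivrMr// ler_pdivlMr// ltr_pdivrMr//.
    by rewrite mulrDl ler_norml; lra.
  have : `|x - x'| <= `|x - cantor_point d| + (`|cantor_point d - cantor_point d'| + `|x' - cantor_point d'|).
    apply: le_trans (ler_distD (cantor_point d) _ _) _; rewrite lerD2l.
    by apply: le_trans (ler_distD (cantor_point d') _ _) _; rewrite lerD2l distrC.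
  lra.
Qed.

(** Where the block functions vanish from index [n] on, the graph of [h] is the image of that of [w]
    under the Lipschitz shear [Tr n]. The other points lie over the closure of the Cantor set. *)
Lemma graph_hnull (t B : R) (C : nat -> R) (w V h : R -> R) : 1 < t -> 0 <= B ->
  (forall eps, 0 < eps -> exists N, forall n, (N <= n)%N ->
     2 ^+ n * ell n `^ (t - 1) <= eps) ->
  (forall x, 0 <= x <= 1 -> h x = w x + V x) ->
  (forall x, 0 <= x <= 1 -> `|h x| <= B) ->
  (forall n x, (forall k, (n <= k)%N -> block_fun k x = 0) ->
     V x = \sum_(k < n) C k * block_fun k x) ->
  hnull t (graph w `[0, 1]) -> hnull t (graph h `[0, 1]).
Proof.
move=> t1 B0 small hE hB VE wt; have t0 : 0 < t by lra.
pose Tr n (q : R * R) := (q.1, q.2 + \sum_(k < n) C k * block_fun k q.1).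
have nT n : hnull t (Tr n @` graph w `[0, 1]).
  have [L L0 HL] := lipschitz_sum n C block_fun_lip.
  apply: (@hnull_lipschitz _ _ (2 + L)) => //; first by lra.
  move=> q q'; apply: le_trans (edist2_le _ _) _ => /=.
  have := edist2_lex q q'; have := edist2_ley q q'; have := HL q.1 q'.1.
  set u := \sum_(k < n) _; set u' := \sum_(k < n) _ => h1 h2 h3.
  have : `|q.2 + u - (q'.2 + u')| <= `|q.2 - q'.2| + `|u - u'|.
    by rewrite opprD addrACA ler_normD.
  have : L * `|q.1 - q'.1| <= L * edist2 q q' by rewrite ler_pM2l.
  lra.
have nC := cantor_graph_hnull t1 B0 hB small.
apply: (hnullS _ (hnullU (hnull_bigcup nT) nC)) => _ [x + <-].
rewrite /= in_itv/= => x01.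
have [[n xn]|nex] := pselect (exists n, forall k, (n <= k)%N -> block_fun k x = 0).
  left; exists n => //; exists (x, w x); first by exists x => //=; rewrite in_itv.
  by rewrite /Tr/= -VE// -hE.
(* Nonzero block functions of arbitrarily large index bring [x] within every [ell n] of the Cantor
   set. *)
right; exists x => //; split => // n; apply: contrapT => nn; apply: nex; exists n => k nk.
by apply/eqP; apply: contrapT => /negP; move/(block_fun_near nk).
Qed.

End UpperBound.

(** * Extending a subspace *)

Section ContinuousFunctions.
Variable R : realType.

(** The Heine-Cantor theorem, from the near-covering form of compactness. *)
Lemma C01_uniform (f : R -> R) (e : R) : C01 f -> 0 < e ->
  exists2 del, 0 < del & forall x y, 0 <= x <= 1 -> 0 <= y <= 1 ->
    `|x - y| < del -> `|f x - f y| <= e.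
Proof.
move=> /subspace_continuousP cf e0; have e2 : 0 < e / 2 by rewrite divr_gt0.
pose Q (del x : R) := 0 <= x <= 1 ->
  forall y, 0 <= y <= 1 -> `|x - y| < del -> `|f x - f y| <= e.
have : \forall del \near 0^'+, `[0, 1] `<=` Q del.
  apply: (iffLR (compact_near_coveringP _) (@segment_compact R 0 1)) => x x01.
  have := cf x x01 => /cvgrPdist_lt/(_ _ e2); rewrite near_withinE => /nbhs_ballP[h /= h0 xh].
  have h2 : 0 < h / 2 by rewrite divr_gt0.
  exists (ball x (h / 2), [set del | del < h / 2]) => /=.
    by split; [exact: nbhsx_ballx|exact: nbhs_right_lt].
  move=> [x' del] /= [xx' dh] x'01 y y01 x'y.
  have close z : 0 <= z <= 1 -> `|x - z| < h -> `|f x - f z| < e / 2.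
    by move=> z01 xz; apply: xh => //=; rewrite in_itv.
  have fx' : `|f x - f x'| < e / 2.
    by apply: close => //; move: xx'; rewrite /ball/=; lra.
  have fy : `|f x - f y| < e / 2.
    apply: close => //; apply: le_lt_trans (ler_distD x' _ _) _.
    by move: xx'; rewrite /ball/=; lra.
  by apply: le_trans (ler_distD (f x) _ _) _; rewrite (distrC (f x')); lra.
move=> [del /= del0 HQ]; exists (del / 2); first by rewrite divr_gt0.
move=> x y x01 y01; apply: (HQ (del / 2)) => //=.
- by rewrite sub0r normrN gtr0_norm ?divr_gt0//; lra.
- by rewrite divr_gt0.
Qed.

Lemma C01_bounded (f : R -> R) : C01 f ->
  exists2 B, 0 <= B & forall x, 0 <= x <= 1 -> `|f x| <= B.
Proof.
move=> cf.
have [c _ fc] := EVT_max (@ler01 R) cf.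
have [d _ fd] := EVT_min (@ler01 R) cf.
exists (`|f c| + `|f d|) => // x x01.
have := fc x; have := fd x; rewrite !in_itv/= => /(_ x01) h1 /(_ x01) h2.
have := ler_norm (f c); have := ler_norm (- f d); rewrite normrN.
have := normr_ge0 (f c); have := normr_ge0 (f d).
by rewrite ler_norml; lra.
Qed.

Lemma C01_lincomb k (c : 'I_k -> R) (f : 'I_k -> R -> R) :
  (forall i, C01 (f i)) -> C01 (lincomb c f).
Proof.
move=> cf; have -> : lincomb c f = \sum_i (fun x => c i * f i x).
  by apply/funext => x; rewrite fct_sumE.
apply: (big_ind (fun g : R -> R => C01 g)).
- by apply: continuous_subspaceT => x; exact: cvg_cst.
- by move=> g h cg ch x; apply: cvgD; [exact: cg|exact: ch].
- by move=> i _ x; apply: cvgM; [exact: cvg_cst|exact: cf].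
Qed.

Lemma C01_family_modulus a (f : 'I_a -> R -> R) (ell : nat -> R) (e : R) :
  (forall m n, (m <= n)%N -> ell n <= ell m) ->
  (forall h, 0 < h -> exists n, ell n < h) ->
  (forall i, C01 (f i)) -> 0 < e ->
  exists N, forall n i x y, (N <= n)%N -> 0 <= x <= 1 -> 0 <= y <= 1 ->
    `|x - y| <= ell n -> `|f i x - f i y| <= e.
Proof.
move=> ell_anti ell_small cf e0.
have /choice[N HN] : forall i, exists N, forall n x y, (N <= n)%N ->
    0 <= x <= 1 -> 0 <= y <= 1 -> `|x - y| <= ell n -> `|f i x - f i y| <= e.
  move=> i; have [h h0 fh] := C01_uniform (cf i) e0.
  have [N Nh] := ell_small h h0; exists N => n x y Nn x01 y01 xy.
  by apply: fh => //; rewrite (le_lt_trans xy)// (le_lt_trans _ Nh)// ell_anti.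
exists (\max_i N i) => n i x y Nn; apply: HN.
by apply: leq_trans Nn; exact: (leq_bigmax i).
Qed.

End ContinuousFunctions.

(** * Construction of the new basis vectors *)

Section Extension.
Variables (R : realType) (s : R).
Hypothesis s12 : 1 < s <= 2.

Let ell := scale s.
Let eta := gap s.
Let ell_gt0 n : 0 < ell n := scale_gt0 s n.
Let ell_half n : 2 * ell n.+1 <= ell n := scale_half s12 n.
Let ell0 : ell 0%N = 1 := scale0 s.
Let ell_anti m n : (m <= n)%N -> ell n <= ell m := ell_le ell_gt0 ell_half (m := m) (n := n).

Let ell_small (h : R) : 0 < h -> exists n, ell n < h.
Proof.
move=> h0; have [N /(_ N (leqnn N))] := half_power_small 1 h0; rewrite mul1r => hN.
by exists N; exact: le_lt_trans (ell_le_half ell0 ell_half N) hN.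
Qed.

Lemma block_positions a (f : 'I_a -> R -> R) : (forall i, C01 (f i)) ->
  exists p : nat -> nat, [/\ p 0%N = 0%N, forall k, ((p k).*2 < p k.+1)%N,
    forall k, 2^-1 ^+ (p k.+1 - p k) <= ell (p k) &
    forall k i x y, 0 <= x <= 1 -> 0 <= y <= 1 ->
      `|x - y| <= ell (p k.+1) -> `|f i x - f i y| <= ell (p k)].
Proof.
move=> cf.
have /choice[nxt Hn] : forall P, exists Q, [/\ (P.*2 < Q)%N, 2^-1 ^+ (Q - P) <= ell P &
    forall i x y, 0 <= x <= 1 -> 0 <= y <= 1 ->
      `|x - y| <= ell Q -> `|f i x - f i y| <= ell P].
  move=> P; have [N HN] := C01_family_modulus ell_anti ell_small cf (ell_gt0 P).
  have [M HM] : exists M, 2^-1 ^+ M <= ell P.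
    have [M /(_ M (leqnn M))] := half_power_small 1 (ell_gt0 P).
    by rewrite mul1r => /ltW; exists M.
  (* [N] serves the modulus of continuity of the family, [M] the fineness of the block, and the last
     summand the doubling. *)
  exists (N + M + P.*2.+1)%N; split.
  - by rewrite addnS ltnS leq_addl.
  - by apply: le_trans HM; apply: ler_wiXn2l; [lra|lra|lia].
  - by move=> i x y; apply: HN; rewrite -addnA leq_addr.
exists (fun k => iter k nxt 0%N); split => // [k|k|k i x y] /=.
- by have [] := Hn (iter k nxt 0%N).
- by have [] := Hn (iter k nxt 0%N).
- by have [_ _] := Hn (iter k nxt 0%N); exact.
Qed.

(** The residue classes partition the blocks, so in a combination each block carries exactly one of
    the coefficients, and each coefficient recurs in every [b] consecutive blocks. *)
Definition residue_coef b (i : 'I_b) k : R := if (k %% b)%N == i then 2^-1 ^+ k else 0.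

Lemma residue_coef_bound b (i : 'I_b) k : 0 <= residue_coef i k <= 2^-1 ^+ k.
Proof. by rewrite /residue_coef; case: ifP => _; rewrite exprn_ge0 ?lexx. Qed.

Definition residue_fun (p : nat -> nat) b (i : 'I_b) : R -> R :=
  series_fun (residue_coef i) (block_fun ell eta p).

Section Combination.
Variables (a b : nat) (f : 'I_a -> R -> R) (p : nat -> nat).
Hypothesis cf : forall i, C01 (f i).
Hypothesis p0 : p 0%N = 0%N.
Hypothesis p_double : forall k, ((p k).*2 < p k.+1)%N.
Hypothesis p_fine : forall k, 2^-1 ^+ (p k.+1 - p k) <= ell (p k).
Hypothesis p_osc : forall k i x y, 0 <= x <= 1 -> 0 <= y <= 1 ->
  `|x - y| <= ell (p k.+1) -> `|f i x - f i y| <= ell (p k).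

Let G : 'I_b -> R -> R := residue_fun p (b := b).
Let eta_gt0 n : 0 < eta n := gap_gt0 s n.
Let y01 := block_fun01 ell eta_gt0 p.

Lemma residue_fun_C01 i : C01 (G i).
Proof.
apply: continuous_subspaceT.
exact: series_fun_continuous (residue_coef_bound i) y01 (block_fun_lipschitz ell eta_gt0 p).
Qed.

Variables (u : 'I_a -> R) (v : 'I_b -> R) (h : R -> R).
Hypothesis hE : forall x, 0 <= x <= 1 -> h x = lincomb u f x + lincomb v G x.

Let C k := \sum_i v i * residue_coef i k.

Let comb_sum n x : \sum_(k < n) C k * block_fun ell eta p k x =
  \sum_i v i * \sum_(k < n) residue_coef i k * block_fun ell eta p k x.
Proof.
under eq_bigr do rewrite /C mulr_suml.
rewrite exchange_big/=; apply: eq_bigr => i _; rewrite mulr_sumr.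
by apply: eq_bigr => k _; rewrite mulrA.
Qed.

Lemma combination_hnull (t : R) : s < t ->
  hnull t (graph (lincomb u f) `[0, 1]) -> hnull t (graph h `[0, 1]).
Proof.
move=> st; have t1 : 1 < t by move: s12; lra.
have [B1 B10 hB1] := C01_bounded (C01_lincomb (c := u) cf).
have [B2 B20 hB2] := C01_bounded (C01_lincomb (c := v) residue_fun_C01).
apply: (@graph_hnull _ ell eta ell0 ell_gt0 ell_half eta_gt0 (scale_gap s12) p p0 p_double
  t (B1 + B2) C _ (lincomb v G)) => //.
- by rewrite addr_ge0.
- by move=> eps; exact: scale_powR_small.
- move=> x x01; rewrite hE//; apply: le_trans (ler_normD _ _) _.
  by apply: lerD; [exact: hB1|exact: hB2].
- move=> n x yx; rewrite comb_sum; apply: eq_bigr => i _; congr (_ * _).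
  exact: (series_fun_finite (residue_coef_bound i) y01).
Qed.

Lemma combination_not_hnull (t : R) : 1 <= t < s -> (exists i, v i != 0) ->
  ~ hnull t (graph h `[0, 1]).
Proof.
move=> t1s [i0 vi0]; have /andP[t1 ts] := t1s.
have [K K0 HK] := scale_powR_large s12 t1s.
have W0 : 0 <= \sum_i `|u i| by exact: sumr_ge0.
have vA : 0 < `|v i0| by rewrite normr_gt0.
(* The tail constant is twice the sum of the [|v i|]; a large block is found among [b] consecutive
   ones, whence [m := b]. *)
apply: (@graph_not_hnull _ ell ell0 ell_gt0 ell_half p p0 p_double p_fine
  C (lincomb u f) (lincomb v G) _ (\sum_i `|v i| * 2) _ b W0 vA _ _ _ t K h t1 K0 HK hE).
- move=> n d.
  have -> : \sum_(k < n) C k * block_val R p k d =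
      \sum_(k < n) C k * block_fun ell eta p k (cantor_point ell d).
    apply: eq_bigr => k _; congr (_ * _); apply/esym.
    exact: (block_fun_cantor_point ell_gt0 ell_half eta_gt0 (scale_gap s12)).
  rewrite comb_sum /lincomb -sumrB mulr_suml; apply: le_trans (ler_norm_sum _ _ _) _.
  apply: ler_sum => i _; rewrite -mulrBr normrM -mulrA ler_wpM2l//.
  exact: series_fun_approx (residue_coef_bound i) y01 _ _.
- move=> k d d' dd'; rewrite /lincomb -sumrB mulr_suml; apply: le_trans (ler_norm_sum _ _ _) _.
  apply: ler_sum => i _; rewrite -mulrBr normrM ler_wpM2l//.
  apply: p_osc; [exact: cantor_point01|exact: cantor_point01|].
  exact: (cantor_point_near ell_gt0 ell_half).
- move=> k; have b0 : (0 < b)%N by exact: leq_ltn_trans (leq0n _) (ltn_ord i0).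
  have xb : (k.+2 %% b < b)%N by rewrite ltn_mod.
  (* The least index from [k.+2] on that is congruent to [i0] modulo [b]. *)
  exists (k.+2 + (b - k.+2 %% b + i0) %% b)%N; set k' := (k.+2 + _)%N.
  have km : (k' %% b = i0)%N.
    rewrite /k' modnDmr -(modnDml k.+2) addnA subnKC; last exact: ltnW.
    by rewrite modnDl modn_small.
  split; first exact: leq_addr.
    have : ((b - k.+2 %% b + i0) %% b < b)%N by rewrite ltn_mod.
    by rewrite /k'; lia.
  rewrite /C (bigD1 i0)//= big1 ?addr0 => [|i ii0].
    by rewrite /residue_coef km eqxx normrM (ger0_norm (exprn_ge0 _ _)).
  by rewrite /residue_coef km val_eqE eq_sym (negbTE ii0) mulr0.
Qed.

End Combination.

Lemma zero_graph_hnull (t : R) : 1 < t -> hnull t (graph (fun=> 0 : R) `[0, 1]).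
Proof.
move=> t1; have t0 : 0 < t by lra.
apply: hnull_finite => // eps del e0 d0.
(* About [1 / r] pieces of length [r] have total at most [2 * r ^ (t - 1)], and [r0] makes this
   [eps]. *)
pose r0 := (eps / 2) `^ (t - 1)^-1.
have r00 : 0 < r0 by rewrite powR_gt0 ?divr_gt0.
pose r := Num.min (Num.min del 1) r0.
have rp : 0 < r by rewrite !lt_min d0 r00 ltr01.
have [rd r1 rr0] : [/\ r <= del, r <= 1 & r <= r0] by rewrite !ge_min !lexx !orbT.
exists (Num.truncn r^-1).+1, r, (fun i => [set q | [/\ 0 <= q.1, q.2 = 0 & Num.truncn (q.1 / r) = i]]).
split; first by rewrite ltW.
- rewrite -(mulr_powRB1 (ltW rp) t0) mulrA.
  have h1 : (Num.truncn r^-1).+1%:R * r <= 2.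
    rewrite -natr1 mulrDl mul1r -[2]/(1 + 1); apply: lerD => //.
    by rewrite -ler_pdivlMr// mul1r truncn_le invr_ge0 ltW.
  have h2 : r `^ (t - 1) <= eps / 2.
    apply: (@le_trans _ _ (r0 `^ (t - 1))).
      by apply: ge0_ler_powR => //; rewrite ?nnegrE ?ltW//; lra.
    rewrite /r0 -powRrM mulVf ?powRr1 ?divr_ge0 ?(ltW e0)//.
    by rewrite gt_eqF//; lra.
  have := powR_ge0 r (t - 1); have : 0 <= (Num.truncn r^-1).+1%:R * r.
    by rewrite mulr_ge0// ltW.
  nra.
- move=> _ [x + <-]; rewrite /= in_itv/= => /andP[x0 x1].
  have xr : 0 <= x / r by rewrite divr_ge0// ltW.
  exists (Num.truncn (x / r)) => //.
  rewrite ltnS truncn_ge_nat ?invr_ge0 ?(ltW rp)//.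
  apply: le_trans (_ : x / r <= _); first by rewrite truncn_le.
  by rewrite ler_pdivrMr// mulVf ?gt_eqF.
- move=> i [x y] [x' y'] [/= x0 -> xi] [/= x'0 -> xi'].
  apply: le_trans (edist2_le _ _) _; rewrite /= subrr normr0 addr0.
  have h1 : 0 <= x / r by rewrite divr_ge0// ltW.
  have h2 : 0 <= x' / r by rewrite divr_ge0// ltW.
  have := truncn_itv h1; have := truncn_itv h2; rewrite xi xi' -natr1.
  rewrite ler_pdivlMr// ltr_pdivrMr// ler_pdivlMr// ltr_pdivrMr//.
  by rewrite mulrDl ler_norml; lra.
Qed.

Lemma Hs_extension a b (f : 'I_a -> R -> R) : lin_indep01 f -> span_in (Hs s) f ->
  exists g : 'I_(a + b) -> R -> R,
    [/\ forall i, g (lshift b i) = f i, lin_indep01 g & span_in (Hs s) g].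
Proof.
move=> [cf free] spanf.
have [p [p0 p_double p_fine p_osc]] := block_positions cf.
pose G (i : 'I_b) := residue_fun p i.
pose g (j : 'I_(a + b)) := match fintype.split j with inl i => f i | inr i => G i end.
have gl i : g (lshift b i) = f i by rewrite /g; case: split_ordP => [? /lshift_inj->|? /eqP]; rewrite ?eq_lrshift.
have gr i : g (rshift a i) = G i by rewrite /g; case: split_ordP => [? /eqP|? /rshift_inj->]; rewrite ?eq_rlshift.
have cg j : C01 (g j) by rewrite /g; case: (fintype.split j) => i; [exact: cf|exact: residue_fun_C01].
have gE c x : lincomb c g x =
    lincomb (fun i => c (lshift b i)) f x + lincomb (fun i => c (rshift a i)) G x.
  rewrite /lincomb big_split_ord/=; congr (_ + _); apply: eq_bigr => i _; first by rewrite gl.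
  by rewrite gr.
have s0 : 0 < s by move: s12; lra.
have span c : (exists j, c j != 0) -> Hs s (lincomb c g).
  move=> [j cj].
  (* If no new vector occurs, the combination lies in the given subspace; otherwise both dimension
     bounds apply. *)
  have [vc|vc] := pselect (exists i, c (rshift a i) != 0); last first.
    have v0 i : c (rshift a i) = 0 by apply/eqP; apply: contrapT => /negP ?; apply: vc; exists i.
    have -> : lincomb c g = lincomb (fun i => c (lshift b i)) f.
      apply/funext => x; rewrite gE [X in _ + X]big1 ?addr0// => i _.
      by rewrite v0 mul0r.
    apply: spanf; case: (split_ordP j) cj => i -> ci; first by exists i.
    by rewrite v0 eqxx in ci.
  split; first exact: C01_lincomb.
  apply: hdim_eq => //.
    move=> t st; apply: (combination_hnull cf p0 p_double (fun x _ => gE c x)) => //.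
    (* The old part either belongs to [Hs s] or is identically zero, with a segment as its graph. *)
    have [uc|uc] := pselect (exists i, c (lshift b i) != 0).
      by have [_] := spanf _ uc; apply: hdim_hnull; rewrite (ltW s0).
    have -> : lincomb (fun i => c (lshift b i)) f = fun=> 0.
      apply/funext => x; rewrite /lincomb big1// => i _.
      suff -> : c (lshift b i) = 0 by rewrite mul0r.
      by apply/eqP; apply: contrapT => /negP ?; apply: uc; exists i.
    by apply: zero_graph_hnull; move: s12; lra.
  exists 1; first by case/andP: s12.
  move=> t /andP[t1 ts].
  apply: (combination_not_hnull p0 p_double p_fine p_osc (fun x _ => gE c x)) => //.
  by rewrite (ltW t1).
(* Independence follows from the span condition: a nontrivial combination vanishing on [0, 1] would
   have a segment as graph, of dimension at most [(1 + s) / 2 < s]. *)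
exists g; split => //; split => // c c0 j; apply/eqP; apply: contrapT => /negP cj.
have [_ dims] : Hs s (lincomb c g) by apply: span; exists j.
have t1 : 1 < (1 + s) / 2 by move: s12; lra.
have : (hdim (graph (lincomb c g) `[0%R, 1%R]) <= ((1 + s) / 2)%:E)%E.
  apply: ereal_inf_lbound; exists ((1 + s) / 2) => //; split; first by lra.
  apply: hnull_hmeasure0; first by lra.
  apply: hnullS (zero_graph_hnull t1) => _ [x x01 <-].
  by exists x => //; rewrite c0.
by rewrite dims lee_fin; move: s12; lra.
Qed.

End Extension.

Theorem theorem3p16 (R : realType) (s : R) (m n : nat) :
  1 < s -> s <= 2 -> (0 < n)%N -> (0 < m)%N ->
  lineable2 (Hs s) n (n + m).
Proof.
move=> s1 s2 n0 m0; have s12 : 1 < s <= 2 by rewrite s1.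
split.
  (* Plain [n]-lineability is the extension of the empty family by [n] vectors. *)
  have free0 : lin_indep01 (fun _ : 'I_0 => (fun=> 0) : R -> R) by split => [[]|c _ []].
  have span0 : span_in (Hs s) (fun _ : 'I_0 => (fun=> 0) : R -> R) by move=> c [[]].
  by have [g [_ gi gs]] := Hs_extension s12 n free0 span0; exists g.
move=> f fi fs; have [g [gf gi gs]] := Hs_extension s12 (n + m - n) fi fs.
by exists g.
Qed.
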